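(* Three-webs $W(3,2,2)$ (with nowhere vanishing covector $a$) for which the integral surfaces $V^2$ of the transversal $a$-distribution $\Delta$ are geodesicly parallel, and the two-dimensional three-webs $W(3,2,1)$ cut on $V^2$ by the foliations of the web $W(3,2,2)$ are hexagonal, exist, and a solution of the system of differential equations defining such webs depends on three arbitrary functions of three variables.
   Context: A web $W(3,2,2)$ on a 4-manifold $M^4$ consists of three foliations $\lambda_1,\lambda_2,\lambda_3$ of codimension 2 in general position (their tangent planes are pairwise transversal at each point). All considerations are local. Indices $i,j,k,l$ range over $\{1,2\}$; repeated indices are summed; square brackets around indices denote alternation with averaging. The foliation $\lambda_u$ is given by $\omega_{(u)}^i=0$, $i=1,2$, where the 1-forms are normalized so that $\omega_{(1)}^i+\omega_{(2)}^i+\omega_{(3)}^i=0$; the forms $\omega_{(1)}^i,\omega_{(2)}^i$ form a coframe on $M^4$. Admissible coframe changes are $\omega_{(\alpha)}^{i'}=A^{i'}_j\omega_{(\alpha)}^j$ with the same nondegenerate matrix for $\alpha=1,2$. The structure equations are $$d\omega_{(1)}^i=\omega_{(1)}^j\wedge\omega_j^i+a_j\omega_{(1)}^j\wedge\omega_{(1)}^i,\qquad d\omega_{(2)}^i=\omega_{(2)}^j\wedge\omega_j^i-a_j\omega_{(2)}^j\wedge\omega_{(2)}^i,$$ which determine the connection forms $\omega_j^i$ and the covector $a=\{a_1,a_2\}$; the torsion tensor is $a^i_{jk}=a_{[j}\delta^i_{k]}$. Further, $$d\omega_j^i-\omega_j^k\wedge\omega_k^i=b^i_{jkl}\,\omega_{(1)}^k\wedge\omega_{(2)}^l,\qquad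 da_i-a_j\omega_i^j=p_{ij}\omega_{(1)}^j+q_{ij}\omega_{(2)}^j,$$ where $b^i_{jkl}$ is the curvature tensor, and $b^i_{[j|l|k]}=\delta^i_{[k}p_{j]l}$, $b^i_{[jk]l}=\delta^i_{[k}q_{j]l}$. The transversal $a$-distribution $\Delta$ is defined by $a_1\omega_{(1)}^1+a_2\omega_{(1)}^2=0$, $a_1\omega_{(2)}^1+a_2\omega_{(2)}^2=0$. On each two-dimensional integral surface $V^2$ of $\Delta$ (when $\Delta$ is integrable) the leaves of the three foliations cut a web $W(3,2,1)$ of three one-dimensional foliations. A two-dimensional three-web is hexagonal if it is locally diffeomorphic to the web of three families of parallel straight lines in the plane. Consider the affine connections on $M^4$ given by $\nabla e_i^\alpha=\theta_i^je_j^\alpha$, where $\{e_i^\alpha\}$ is the frame dual to $\{\omega_{(\alpha)}^i\}$ and $\theta_j^i=\omega_j^i+a^i_{jk}(p\,\omega_{(1)}^k+q\,\omega_{(2)}^k)$ with parameters $p,q$. The integral surfaces of $\Delta$ are geodesicly parallel if $\Delta$ is integrable and, in any connection of this family, $\nabla_XY\in\Delta$ for every section $Y$ of $\Delta$ and every vector $X$ tangent to $M^4$. One may always specialize the frames so that $a_2=0$; then $\Delta$ is given by $\omega_{(1)}^1=\omega_{(2)}^1=0$, the integral surfaces are geodesicly parallel if and only if $\omega_2^1=0$ (equivalently $p_{2i}=q_{2i}=0$), and the webs $W(3,2,1)$ are hexagonal if and only if $b^2_{222}=0$. The system of differential equations defining the webs in question is the system of the equations $d\omega_{(1)}^i=\omega_{(1)}^j\wedge\omega_j^i+a_j\omega_{(1)}^j\wedge\omega_{(1)}^i$,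 $d\omega_{(2)}^i=\omega_{(2)}^j\wedge\omega_j^i-a_j\omega_{(2)}^j\wedge\omega_{(2)}^i$, $d\omega_j^i-\omega_j^k\wedge\omega_k^i=b^i_{jkl}\,\omega_{(1)}^k\wedge\omega_{(2)}^l$, $da_i-a_j\omega_i^j=p_{ij}\omega_{(1)}^j+q_{ij}\omega_{(2)}^j$, $b^i_{[j|l|k]}=\delta^i_{[k}p_{j]l}$, $b^i_{[jk]l}=\delta^i_{[k}q_{j]l}$ with $a_2=0$, $a_1\neq0$, $\omega_2^1=0$, $b^2_{222}=0$, together with its differential consequences, in which the components of $p_{ij},q_{ij},b^i_{jkl}$ not determined by the other ones are unknown functions. The phrase ''a solution depends on $k$ arbitrary functions of three variables'' is meant in the sense of Cartan's theory of exterior differential systems (real-analytic category): the system is in involution (Cartan's test is satisfied), and its last nonzero Cartan character is $s_3=k$. *)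

(* Defs.v *)
From HB Require Import structures.
From mathcomp Require Import all_boot all_order all_algebra.
From mathcomp Require Import all_classical all_reals all_analysis.
Set Implicit Arguments.
Unset Strict Implicit.
Unset Printing Implicit Defensive.
Import Order.TTheory GRing.Theory Num.Theory numFieldNormedType.Exports.
Local Open Scope classical_set_scope.
Local Open Scope ring_scope.

(* Conventions: indices range over 'I_2, the values 0 and 1 standing for the
   indices 1 and 2 of the usual notation.  A doubly indexed form w_j^i is
   written [w j i], lower index first.  On two vectors,
   (a /\ b)(u, v) = a(u) b(v) - a(v) b(u), without a factor 1/2. *)

Section Calculus.
Variable R : realType.

Definition pderiv n (i : 'I_n) (f : 'rV[R]_n -> R) (x : 'rV[R]_n) : R :=
  'D_(delta_mx 0 i) f x.

Definition smooth_on n (U : set 'rV[R]_n) (f : 'rV[R]_n -> R) : Prop :=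
  forall (s : seq 'I_n) (x : 'rV[R]_n), U x ->
    differentiable (foldr (@pderiv n) f s) x.

Definition smooth_map_on n m (U : set 'rV[R]_n) (f : 'rV[R]_n -> 'rV[R]_m) :=
  forall i : 'I_m, smooth_on U (fun x => f x 0 i).

(* The homogeneous part of degree k of the power series with coefficients c,
   the exponents of the monomials being the families of naturals of sum k. *)
Definition homog_part n (c : ('I_n -> nat) -> R) (k : nat) (h : 'I_n -> R) : R :=
  \sum_(e : {ffun 'I_n -> 'I_k.+1} | (\sum_i e i)%N == k)
    c (fun i => e i) * \prod_i h i ^+ e i.

Definition analytic_on n (U : set 'rV[R]_n) (f : 'rV[R]_n -> R) : Prop :=
  forall x, U x -> exists (c : ('I_n -> nat) -> R) (r : R),
    0 < r /\ forall h : 'rV[R]_n, (forall i, `|h 0 i| < r) ->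
      cvgn (series (fun k => homog_part (fun e => `|c e|) k (fun i => `|h 0 i|)))
      /\ series (fun k => homog_part c k (h 0)) @ \oo --> f (x + h).

(* A 1-form sum_i w_i dx^i is the family of its coefficients. *)
Definition oneform n := 'I_n -> 'rV[R]_n -> R.

Definition form_at n (w : oneform n) (x v : 'rV[R]_n) : R :=
  \sum_i w i x * v 0 i.

Definition dform n (w : oneform n) (x u v : 'rV[R]_n) : R :=
  \sum_i \sum_j pderiv i (w j) x * (u 0 i * v 0 j - v 0 i * u 0 j).

Definition wedge2 n (w w' : oneform n) (x u v : 'rV[R]_n) : R :=
  form_at w x u * form_at w' x v - form_at w x v * form_at w' x u.

Definition analytic_form n (U : set 'rV[R]_n) (w : oneform n) : Prop :=
  forall i, analytic_on U (w i).

Definition plane_field n := 'rV[R]_n -> set 'rV[R]_n.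

(* [sigma], defined on the open set S of the plane, parametrizes an immersed
   surface in U whose tangent planes are contained in D. *)
Definition tangent_surface n (U : set 'rV[R]_n) (D : plane_field n)
    (S : set 'rV[R]_2) (sigma : 'rV[R]_2 -> 'rV[R]_n) : Prop :=
  [/\ open S, smooth_map_on S sigma,
      (forall s, S s -> U (sigma s)),
      (forall s v, S s -> 'D_v sigma s = 0 -> v = 0)
    & (forall s v, S s -> D (sigma s) ('D_v sigma s))].

(* To be used for distributions of rank 2. *)
Definition integrable2 n (U : set 'rV[R]_n) (D : plane_field n) : Prop :=
  forall x, U x -> exists S sigma,
    tangent_surface U D S sigma /\ exists2 s, S s & sigma s = x.

End Calculus.

Section Webs.
Variable R : realType.

(* [wform W u i] is the form omega_(u+1)^(i+1), for u in 'I_3. *)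
Record web_data := WebData {
  wdom : set 'rV[R]_4;
  wform : 'I_3 -> 'I_2 -> oneform R 4 }.

Definition leaf_dist (W : web_data) (u : 'I_3) : plane_field R 4 :=
  fun x v => forall i, form_at (wform W u i) x v = 0.

(* The last but one condition is the general position: it says that the four
   forms defining two of the foliations are linearly independent, so that in
   particular each [leaf_dist W u] has rank 2. *)
Definition is_web (W : web_data) : Prop :=
  [/\ open (wdom W), wdom W !=set0,
      (forall u i, analytic_form (wdom W) (wform W u i)),
      (forall u u' x v, u != u' -> wdom W x ->
         leaf_dist W u x v -> leaf_dist W u' x v -> v = 0)
    & (forall u, integrable2 (wdom W) (leaf_dist W u))].

Definition normalized (W : web_data) : Prop :=
  forall i x v, wdom W x -> \sum_u form_at (wform W u i) x v = 0.

Local Notation om1 W := (wform W 0).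
Local Notation om2 W := (wform W 1).

(* [conn j i] is the connection form omega_j^i. *)
Definition structure_equations (W : web_data)
    (conn : 'I_2 -> 'I_2 -> oneform R 4) (a : 'I_2 -> 'rV[R]_4 -> R) : Prop :=
  [/\ (forall i j, analytic_form (wdom W) (conn j i)),
      (forall i, analytic_on (wdom W) (a i)),
      (forall i x u v, wdom W x ->
         dform (om1 W i) x u v =
           \sum_j wedge2 (om1 W j) (conn j i) x u v
           + \sum_j a j x * wedge2 (om1 W j) (om1 W i) x u v)
    & (forall i x u v, wdom W x ->
         dform (om2 W i) x u v =
           \sum_j wedge2 (om2 W j) (conn j i) x u v
           - \sum_j a j x * wedge2 (om2 W j) (om2 W i) x u v)].

Definition nowhere_zero (W : web_data) (a : 'I_2 -> 'rV[R]_4 -> R) : Prop :=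
  forall x, wdom W x -> exists i, a i x != 0.

Definition a_dist (W : web_data) (a : 'I_2 -> 'rV[R]_4 -> R) :
    plane_field R 4 :=
  fun x v => \sum_i a i x * form_at (om1 W i) x v = 0
          /\ \sum_i a i x * form_at (om2 W i) x v = 0.

(* The torsion tensor a^i_{jk} = a_[j delta^i_k]. *)
Definition torsion (a : 'I_2 -> 'rV[R]_4 -> R) (i j k : 'I_2) x : R :=
  (a j x * (i == k)%:R - a k x * (i == j)%:R) / 2.

Definition theta (W : web_data) (conn : 'I_2 -> 'I_2 -> oneform R 4)
    (a : 'I_2 -> 'rV[R]_4 -> R) (p q : R) (j i : 'I_2) (x v : 'rV[R]_4) : R :=
  form_at (conn j i) x v
  + \sum_k torsion a i j k x
      * (p * form_at (om1 W k) x v + q * form_at (om2 W k) x v).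

(* The component on e_i^alpha of the covariant derivative, in the direction X
   at the point x, of the vector field Y; the component of Y itself on
   e_j^alpha is omega_(alpha)^j(Y). *)
Definition covariant_comp (W : web_data) (conn : 'I_2 -> 'I_2 -> oneform R 4)
    (a : 'I_2 -> 'rV[R]_4 -> R) (p q : R) (alpha : 'I_3) (i : 'I_2)
    (Y : 'rV[R]_4 -> 'rV[R]_4) (x X : 'rV[R]_4) : R :=
  'D_X (fun y => form_at (wform W alpha i) y (Y y)) x
  + \sum_j form_at (wform W alpha j) x (Y x) * theta W conn a p q j i x X.

Definition geodesicly_parallel (W : web_data)
    (conn : 'I_2 -> 'I_2 -> oneform R 4) (a : 'I_2 -> 'rV[R]_4 -> R) : Prop :=
  integrable2 (wdom W) (a_dist W a) /\
  forall (p q : R) (N : set 'rV[R]_4) (Y : 'rV[R]_4 -> 'rV[R]_4),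
    open N -> N `<=` wdom W -> smooth_map_on N Y ->
    (forall y, N y -> a_dist W a y (Y y)) ->
    forall x X, N x ->
      \sum_i a i x * covariant_comp W conn a p q 0 i Y x X = 0
      /\ \sum_i a i x * covariant_comp W conn a p q 1 i Y x X = 0.

(* A planar three-web on S is given by its three direction fields;
   [l u] is the linear form whose level lines are the lines of the u-th
   family of parallel lines. *)
Definition hexagonal (S : set 'rV[R]_2) (L : 'I_3 -> plane_field R 2) : Prop :=
  forall s, S s ->
  exists (N : set 'rV[R]_2) (phi : 'rV[R]_2 -> 'rV[R]_2) (l : 'I_3 -> 'cV[R]_2),
    [/\ open N, N s, N `<=` S
      & [/\ smooth_map_on N phi,
            (forall t t', N t -> N t' -> phi t = phi t' -> t = t'),
            (forall t v, N t -> 'D_v phi t = 0 -> v = 0),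
            (forall u u', u != u' -> \det (row_mx (l u) (l u')) != 0)
          & (forall t u v, N t -> (L u t v <-> ('D_v phi t *m l u) 0 0 = 0))]].

Definition hexagonal_sections (W : web_data) (a : 'I_2 -> 'rV[R]_4 -> R) :=
  forall S sigma, tangent_surface (wdom W) (a_dist W a) S sigma ->
    hexagonal S (fun u s v => leaf_dist W u (sigma s) ('D_v sigma s)).

End Webs.

(* Exterior differential systems of the following type: the basis of 1-forms
   consists of the forms eta_x of a coframe (x in X), which are the
   independent ones, and of the differentials dz_y of unknown functions
   (y in Y); the differentials d eta_x are prescribed expressions [T x] in
   the z_y and eta_x, and further forms [G] are required to vanish. *)

Section ExteriorSystems.
Variables (R : fieldType) (X Y : finType).

Inductive fexpr :=
| FCst of R
| FVar of Y
| FCof of X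
| FDVar of Y
| FAdd of fexpr & fexpr
| FMul of fexpr & fexpr.  (* exterior product *)

Definition FOpp e := FMul (FCst (-1)) e.
Definition FSub e e' := FAdd e (FOpp e').
Definition FSum2 (F : 'I_2 -> fexpr) := FAdd (F 0) (F 1).

(* The automorphism acting on the forms of degree k by (-1)^k. *)
Fixpoint fbar (e : fexpr) : fexpr :=
  match e with
  | FCst _ | FVar _ => e
  | FCof _ | FDVar _ => FOpp e
  | FAdd e1 e2 => FAdd (fbar e1) (fbar e2)
  | FMul e1 e2 => FMul (fbar e1) (fbar e2)
  end.

(* The exterior differential.  Here d (d eta_x) = 0 is not an identity but
   an equation for the unknown functions. *)
Fixpoint fd (T : X -> fexpr) (e : fexpr) : fexpr :=
  match e with
  | FCst _ | FDVar _ => FCst 0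
  | FVar y => FDVar y
  | FCof x => T x
  | FAdd e1 e2 => FAdd (fd T e1) (fd T e2)
  | FMul e1 e2 => FAdd (FMul (fd T e1) e2) (FMul (fbar e1) (fd T e2))
  end.

(* A tangent vector is given by the values of the eta_x and the dz_y on it. *)
Definition tvec := {ffun X + Y -> R^o}.

(* A form at a point is represented by its values on all finite sequences of
   vectors; a form of degree k vanishes on the sequences of size <> k.  The
   interior product by v is then precomposition with [cons v], and [fwedge]
   expresses that it is an antiderivation. *)
Fixpoint fwedge (f g : seq tvec -> R) (s : seq tvec) : R :=
  if s is v :: s' then
    fwedge (fun t => f (v :: t)) g s'
    + fwedge (fun t => (-1) ^+ size t * f t) (fun t => g (v :: t)) s'
  else f [::] * g [::].

Fixpoint feval (z : Y -> R) (e : fexpr) (s : seq tvec) : R :=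
  match e with
  | FCst c => if s is [::] then c else 0
  | FVar y => if s is [::] then z y else 0
  | FCof x => if s is [:: v] then v (inl x) else 0
  | FDVar y => if s is [:: v] then v (inr y) else 0
  | FAdd e1 e2 => feval z e1 s + feval z e2 s
  | FMul e1 e2 => fwedge (feval z e1) (feval z e2) s
  end.

Variables (T : X -> fexpr) (G : fexpr -> Prop).

(* Algebraic generators of the differential ideal; it is closed under d,
   because d (d e) is in the ideal generated by the d (d eta_x) for any e. *)
Inductive generator : fexpr -> Prop :=
| gen_form e of G e : generator e
| gen_dform e of G e : generator (fd T e)
| gen_ddcof x : generator (fd T (T x)).

Definition integral_element (z : Y -> R) (E : tvec -> Prop) : Prop :=
  forall e, generator e -> forall s : seq tvec,
    (forall v, v \in s -> E v) -> feval z e s = 0.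

Definition polar (z : Y -> R) (E : tvec -> Prop) (v : tvec) : Prop :=
  forall e, generator e -> forall s : seq tvec,
    (forall u, u \in s -> E u) -> feval z e (v :: s) = 0.

(* Forms of positive degree vanish on the empty sequence. *)
Definition zero_locus (z : Y -> R) : Prop :=
  forall e, generator e -> feval z e [::] = 0.

(* The elements of dimension #|X| on which the eta_x are independent: they
   are given by equations dz_y = sum_x p_(y,x) eta_x. *)
Definition graph (p : {ffun Y * X -> R^o}) (v : tvec) : Prop :=
  forall y, v (inr y) = \sum_x p (y, x) * v (inl x).

(* Cartan's test at a point z, with characters s_0, s_1, ..., s_n, where
   n = #|X|.  There is a flag E_0 < E_1 < ... < E_n of integral elements,
   E_n being as in [graph], such that the polar space of E_k has codimension
   s_0 + ... + s_k for k < n, the sum of all the characters being the number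
   of unknown functions; and the integral elements at z of the form [graph]
   depend on s_1 + 2 s_2 + ... + n s_n parameters.  We consider systems for
   which these integral elements form an affine space. *)
Definition cartan_test (z : Y -> R) (s : nat -> nat) : Prop :=
  let n := #|X| in
  [/\ exists E : nat -> {vspace tvec},
        [/\ (forall k, (k <= n)%N ->
               \dim (E k) = k /\ integral_element z (fun v => v \in E k)),
            (forall k, (k < n)%N -> (E k <= E k.+1)%VS),
            (exists p, forall v, v \in E n <-> graph p v)
          & (forall k, (k < n)%N -> exists2 H : {vspace tvec},
               (forall v, v \in H <-> polar z (fun u => u \in E k) v)
               & (\dim H + \sum_(j < k.+1) s j = #|X| + #|Y|)%N)],
      (\sum_(j < n.+1) s j = #|Y|)%N
    & exists (p0 : {ffun Y * X -> R^o}) (L : {vspace {ffun Y * X -> R^o}}),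
        (forall p, integral_element z (graph p) <-> p - p0 \in L)
        /\ (\dim L = \sum_(j < n.+1) j * s j)%N].

(* Involution on the part of the zero locus contained in [U], with the same
   characters at all points.  We consider systems for which the zero locus is
   an affine space. *)
Definition in_involution (U : (Y -> R) -> Prop) (s : nat -> nat) : Prop :=
  [/\ exists (z0 : {ffun Y -> R^o}) (L : {vspace {ffun Y -> R^o}}),
        forall z : {ffun Y -> R^o}, zero_locus z <-> z - z0 \in L,
      (exists2 z, U z & zero_locus z)
    & forall z, U z -> zero_locus z -> cartan_test z s].

End ExteriorSystems.

Section WebSystem.
Variable R : fieldType.

(* Coframe: omega_(1)^i, omega_(2)^i, omega_1^1 ([None]) and omega_j^2
   ([Some j]), on the manifold of the frames in which a_2 = 0; the form
   omega_2^1 is zero. *)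
Definition cof : finType := ('I_2 + 'I_2 + option 'I_2)%type.

(* Unknown functions: a_i, p_ij, q_ij and b^i_jkl. *)
Definition unk : finType :=
  ('I_2 + 'I_2 * 'I_2 + 'I_2 * 'I_2 + 'I_2 * 'I_2 * 'I_2 * 'I_2)%type.

Local Notation expr := (fexpr R cof unk).
Local Infix "+f" := (@FAdd R cof unk) (at level 50, left associativity).
Local Infix "-f" := (@FSub R cof unk) (at level 50, left associativity).
Local Infix "*f" := (@FMul R cof unk) (at level 40, left associativity).
Local Notation "\sum2_ i F" := (@FSum2 R cof unk (fun i => F))
  (at level 36, i name, F at level 36).

Definition w1 (i : 'I_2) : expr := FCof R unk (inl (inl i)).
Definition w2 (i : 'I_2) : expr := FCof R unk (inl (inr i)).
Definition om (j i : 'I_2) : expr :=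
  if i == 1 then FCof R unk (inr (Some j))
  else if j == 0 then FCof R unk (inr None)
  else FCst cof unk 0.

Definition fa (i : 'I_2) : expr := FVar R cof (inl (inl (inl i))).
Definition fp (i j : 'I_2) : expr := FVar R cof (inl (inl (inr (i, j)))).
Definition fq (i j : 'I_2) : expr := FVar R cof (inl (inr (i, j))).
(* [fb i j k l] is b^i_jkl. *)
Definition fb (i j k l : 'I_2) : expr := FVar R cof (inr (i, j, k, l)).

Definition kron (i j : 'I_2) : expr := FCst cof unk (i == j)%:R.

Definition dw1 (i : 'I_2) : expr :=
  (\sum2_j (w1 j *f om j i)) +f (\sum2_j (fa j *f (w1 j *f w1 i))).
Definition dw2 (i : 'I_2) : expr :=
  (\sum2_j (w2 j *f om j i)) -f (\sum2_j (fa j *f (w2 j *f w2 i))).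
Definition dom (j i : 'I_2) : expr :=
  (\sum2_k (om j k *f om k i))
  +f (\sum2_k (\sum2_l (fb i j k l *f (w1 k *f w2 l)))).

Definition web_cof_d (x : cof) : expr :=
  match x with
  | inl (inl i) => dw1 i
  | inl (inr i) => dw2 i
  | inr None => dom 0 0
  | inr (Some j) => dom j 1
  end.

Local Notation d := (fd web_cof_d).

(* The equations b^1_2kl = 0 and p_2i = q_2i = 0 are the consequences of
   [we_dom 1 0] and [we_da 1] when a_2 = 0 and omega_2^1 = 0. *)
Inductive web_equations : expr -> Prop :=
| we_a2 : web_equations (fa 1)
| we_hexagonal : web_equations (fb 1 1 1 1)
| we_dom j i : web_equations (d (om j i) -f dom j i)
| we_da i : web_equations
    (d (fa i) -f (\sum2_j (fa j *f om i j))
       -f (\sum2_j (fp i j *f w1 j) +f \sum2_j (fq i j *f w2 j)))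
| we_bp i j k l : web_equations
    ((fb i j l k -f fb i k l j) -f (kron i k *f fp j l -f kron i j *f fp k l))
| we_bq i j k l : web_equations
    ((fb i j k l -f fb i k j l) -f (kron i k *f fq j l -f kron i j *f fq k l))
| we_p2 i : web_equations (fp 1 i)
| we_q2 i : web_equations (fq 1 i)
| we_b12 k l : web_equations (fb 0 1 k l).

Definition a1_neq0 (z : unk -> R) : Prop := z (inl (inl (inl 0))) != 0.

End WebSystem.

(* Main.v *)
(* An explicit web: in the coordinates (x, u, y, v) take
   omega_(1) = (dx, e^x du), omega_(2) = (dy, e^-y dv), with omega_j^i = 0 and
   a = (1, 0).  The surfaces V^2 are given by constant x and y; on them u, v and
   e^x u + e^-y v have the leaves as level lines.

   Involution: the linear equations leave nine unknown functions, and da_1 is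
   determined.  Write pi for the differentials of the eight remaining ones minus
   their values on one integral element, and w1, w2, w3, w4 for omega_(1)^1,
   omega_(1)^2, omega_(2)^1, omega_(2)^2.  The ideal is generated by the linear
   relations and the forms
     w1 pi_p11 + w2 pi_p12 + w3 pi_q11 + w4 pi_q12,    w1 w3 pi_b1111,
     w1 w3 pi_b2111 + w1 w4 (pi_p11 + pi_b2211) + w2 w3 (pi_q11 + pi_b2211)
       + w2 w4 pi_b2122,
     w1 w3 pi_b2211 + w1 w4 (pi_b2122 - pi_q12) + w2 w3 (pi_b2122 - pi_p12).
   Integral elements thus form an affine space of dimension 18, and the flag of
   e_1, e_3, e_2 + e_4, e_4, ... yields the characters 18, 1, 4, 3. *)
Require Import Defs.
From HB Require Import structures.
From mathcomp Require Import all_boot all_order all_algebra.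
From mathcomp Require Import all_classical all_reals all_analysis.
From mathcomp Require Import ring lra zify.
Set Implicit Arguments.
Unset Strict Implicit.
Unset Printing Implicit Defensive.
Import Order.TTheory GRing.Theory Num.Theory numFieldNormedType.Exports.
Local Open Scope classical_set_scope.
Local Open Scope ring_scope.

Lemma ord2_ind (P : 'I_2 -> Prop) : P 0 -> P 1 -> forall i, P i.
Proof.
move=> P0 P1 [[|[|m]] lt_m] //.
- by rewrite (_ : Ordinal lt_m = 0) //; apply: val_inj.
- by rewrite (_ : Ordinal lt_m = 1) //; apply: val_inj.
Qed.

(** * Evaluation of exterior forms *)

Section FormEvaluation.
Variables (R : fieldType) (X Y : finType).
Implicit Types (z : Y -> R) (e : fexpr R X Y) (u v w : tvec R X Y).
Implicit Types (f g : seq (tvec R X Y) -> R) (s : seq (tvec R X Y)).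

(* [None] is a zero known syntactically: evaluation then drops vanishing terms. *)
Definition oadd (a b : option R) : option R :=
  match a, b with
  | Some x, Some y => Some (x + y)
  | None, _ => b
  | _, None => a
  end.

Definition omul (a b : option R) : option R :=
  match a, b with Some x, Some y => Some (x * y) | _, _ => None end.

Definition oopp (a : option R) : option R :=
  match a with Some x => Some (- x) | None => None end.

Local Notation oval := (odflt 0).
Local Notation "a +o b" := (oadd a b) (at level 50, left associativity).
Local Notation "a *o b" := (omul a b) (at level 40, left associativity).
Local Notation "a -o b" := (oadd a (oopp b)) (at level 50, left associativity).

Lemma oaddE a b : oval (a +o b) = oval a + oval b.
Proof. by case: a b => [x|] [y|] //=; rewrite ?addr0 ?add0r. Qed.

Lemma omulE a b : oval (a *o b) = oval a * oval b.
Proof. by case: a b => [x|] [y|] //=; rewrite ?mulr0 ?mul0r. Qed.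

Lemma ooppE a : oval (oopp a) = - oval a.
Proof. by case: a => [x|] //=; rewrite oppr0. Qed.

Definition ovec (u : X + Y -> option R) : tvec R X Y := [ffun x => oval (u x)].

Implicit Types (zo : Y -> option R) (uo vo wo : X + Y -> option R).

(** [ev0] to [ev3] evaluate a form on 0, 1, 2 and 3 vectors, with the shuffle sum behind [fwedge]
    written out once per degree. They compute by simplification, and the identities left over are
    small enough for [ring]. *)
Fixpoint ev0 zo e : option R :=
  match e with
  | FCst c => Some c
  | FVar y => zo y
  | FCof _ | FDVar _ => None
  | FAdd e1 e2 => ev0 zo e1 +o ev0 zo e2
  | FMul e1 e2 => ev0 zo e1 *o ev0 zo e2
  end.

Fixpoint ev1 zo e uo : option R :=
  match e with
  | FCst _ | FVar _ => None
  | FCof x => uo (inl x)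
  | FDVar y => uo (inr y)
  | FAdd e1 e2 => ev1 zo e1 uo +o ev1 zo e2 uo
  | FMul e1 e2 => ev1 zo e1 uo *o ev0 zo e2 +o ev0 zo e1 *o ev1 zo e2 uo
  end.

Fixpoint ev2 zo e uo vo : option R :=
  match e with
  | FAdd e1 e2 => ev2 zo e1 uo vo +o ev2 zo e2 uo vo
  | FMul e1 e2 =>
      ev2 zo e1 uo vo *o ev0 zo e2 +o ev1 zo e1 uo *o ev1 zo e2 vo
      -o ev1 zo e1 vo *o ev1 zo e2 uo +o ev0 zo e1 *o ev2 zo e2 uo vo
  | _ => None
  end.

Fixpoint ev3 zo e uo vo wo : option R :=
  match e with
  | FAdd e1 e2 => ev3 zo e1 uo vo wo +o ev3 zo e2 uo vo wo
  | FMul e1 e2 =>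
      ev3 zo e1 uo vo wo *o ev0 zo e2 +o ev0 zo e1 *o ev3 zo e2 uo vo wo
      +o (ev1 zo e1 uo *o ev2 zo e2 vo wo -o ev1 zo e1 vo *o ev2 zo e2 uo wo
         +o ev1 zo e1 wo *o ev2 zo e2 uo vo)
      +o (ev2 zo e1 vo wo *o ev1 zo e2 uo -o ev2 zo e1 uo wo *o ev1 zo e2 vo
         +o ev2 zo e1 uo vo *o ev1 zo e2 wo)
  | _ => None
  end.

Lemma feval0E zo e : feval (oval \o zo) e [::] = oval (ev0 zo e).
Proof. by elim: e => //= [e1 -> e2 -> | e1 -> e2 ->]; rewrite ?oaddE ?omulE. Qed.

Lemma feval1E zo e uo : feval (oval \o zo) e [:: ovec uo] = oval (ev1 zo e uo).
Proof.
elim: e => //= [x|y|e1 -> e2 -> | e1 IH1 e2 IH2] //; rewrite ?ffunE ?oaddE //.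
by rewrite !feval0E IH1 IH2 expr0 mul1r !omulE.
Qed.

Lemma feval2E zo e uo vo :
  feval (oval \o zo) e [:: ovec uo; ovec vo] = oval (ev2 zo e uo vo).
Proof.
elim: e => //= [e1 -> e2 -> | e1 IH1 e2 IH2]; rewrite ?oaddE //.
rewrite !feval0E !feval1E IH1 IH2 /= !(oaddE, omulE, ooppE); ring.
Qed.

Lemma feval3E zo e uo vo wo :
  feval (oval \o zo) e [:: ovec uo; ovec vo; ovec wo] = oval (ev3 zo e uo vo wo).
Proof.
elim: e => //= [e1 -> e2 -> | e1 IH1 e2 IH2]; rewrite ?oaddE //.
rewrite !feval0E !feval1E !feval2E IH1 IH2 /= !(oaddE, omulE, ooppE); ring.
Qed.

Lemma fwedge0l f g s : (forall t, f t = 0) -> fwedge f g s = 0.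
Proof.
elim: s f g => [|v s IH] f g f0 /=; first by rewrite f0 mul0r.
by rewrite !IH ?addr0 // => t; rewrite f0 ?mulr0.
Qed.

Lemma fwedge0r f g s : (forall t, g t = 0) -> fwedge f g s = 0.
Proof.
elim: s f g => [|v s IH] f g g0 /=; first by rewrite g0 mulr0.
by rewrite !IH ?addr0 // => t; rewrite g0.
Qed.

(** Each vector is fed to one of the two factors and lowers its bound by one. The bounds [m] and [n]
    are strict, so the product has degree at most [m + n - 2]; a bound 0 makes a factor vanish
    identically. *)
Lemma fwedge_deg f g m n s :
    (forall t, (m <= size t)%N -> f t = 0) ->
    (forall t, (n <= size t)%N -> g t = 0) ->
  (m + n <= (size s).+1)%N -> fwedge f g s = 0.
Proof.
elim: s f g m n => [|v s IH] f g [|m] [|n] f0 g0 /= le.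
- by rewrite f0 ?mul0r.
- by rewrite f0 ?mul0r.
- by rewrite g0 ?mulr0.
- by move: le; rewrite addnS.
- by rewrite fwedge0l ?fwedge0l ?addr0 // => t; rewrite f0 ?mulr0.
- by rewrite fwedge0l ?fwedge0l ?addr0 // => t; rewrite f0 ?mulr0.
- by rewrite fwedge0r ?fwedge0r ?addr0 // => t; rewrite g0.
have -> : fwedge (fun t => f (v :: t)) g s = 0.
  apply: (IH _ _ m n.+1) => // t le_m; exact: f0.
rewrite add0r; apply: (IH _ _ m.+1 n) => [t le_m|t le_n|].
- by rewrite f0 ?mulr0.
- exact: g0.
- by move: le; rewrite addnS.
Qed.

Fixpoint fdeg e : nat :=
  match e with
  | FCst _ | FVar _ => 0
  | FCof _ | FDVar _ => 1
  | FAdd e1 e2 => maxn (fdeg e1) (fdeg e2)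
  | FMul e1 e2 => fdeg e1 + fdeg e2
  end.

Lemma feval_deg z e s : (fdeg e < size s)%N -> feval z e s = 0.
Proof.
elim: e s => [c|y|x|y|e1 IH1 e2 IH2|e1 IH1 e2 IH2] s /=.
- by case: s.
- by case: s.
- by case: s => [|u []].
- by case: s => [|u []].
- by rewrite gtn_max => /andP[l1 l2]; rewrite IH1 ?IH2 ?addr0.
- by move=> lt; apply: (fwedge_deg IH1 IH2); rewrite addSn addnS.
Qed.

Lemma fdeg_bar e : fdeg (fbar e) = fdeg e.
Proof. by elim: e => //= e1 -> e2 ->. Qed.

Lemma fdeg_fd (T : X -> fexpr R X Y) e :
  (forall x, (fdeg (T x) <= 2)%N) -> (fdeg (fd T e) <= (fdeg e).+1)%N.
Proof.
move=> T2; elim: e => //= e1 IH1 e2 IH2; rewrite ?fdeg_bar; lia.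
Qed.

Lemma feval_fd_nil z (T : X -> fexpr R X Y) e :
  (forall x, feval z (T x) [::] = 0) -> feval z (fd T e) [::] = 0.
Proof.
move=> T0; elim: e => //= e1 IH1 e2 IH2; first by rewrite IH1 IH2 addr0.
by rewrite IH1 IH2 mul0r mulr0 addr0.
Qed.

End FormEvaluation.

(** Turns an injective linear parametrization into a flag: [F k] is the image of the rows supported
    on the first [k] coordinates, the embedding of ['rV_k] being multiplication by [pid_mx k]. It
    serves for the direction space of the integral elements and for the flag of Cartan's test. *)
Lemma flag_param (R : fieldType) (V : vectType R) n (f : {linear 'rV[R]_n -> V}) :
  injective f ->
  exists F : nat -> {vspace V}, forall k, (k <= n)%N ->
    \dim (F k) = k /\ forall v, v \in F k <->
      exists2 c, v = f c & forall i : 'I_n, (k <= i)%N -> c 0 i = 0.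
Proof.
move=> f_inj.
pose g k := linfun (f \o mulmxr (pid_mx k : 'M[R]_(k, n))).
exists (fun k => limg (g k)) => k le_kn; split.
  have ker0 : lker (g k) == 0%VS.
    apply/lker0P => c c'; rewrite !lfunE => /f_inj /=.
    move=> /(congr1 (mulmxr (pid_mx k : 'M[R]_(n, k)))) /=.
    by rewrite -!mulmxA mul_pid_mx !minnn (minn_idPr le_kn) pid_mx_1 !mulmx1.
  by rewrite limg_dim_eq ?(eqP ker0) ?capv0 // dimvf dim_matrix; exact: mul1n.
move=> v; split=> [/memv_imgP[c _ ->]|[c -> c0]].
  rewrite lfunE /=; exists (c *m pid_mx k) => // i le_ki.
  rewrite mxE big1 // => j _; rewrite mxE.
  case: eqP => [eq_ji|]; last by rewrite mulr0.
  by move: le_ki; rewrite -eq_ji leqNgt ltn_ord.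
apply/memv_imgP; exists (c *m (pid_mx k : 'M[R]_(n, k))); first exact: memvf.
rewrite lfunE /= -mulmxA mul_pid_mx !minnn; congr (f _).
apply/rowP => i; rewrite mxE (bigD1 i) //= mxE eqxx /=.
rewrite big1 ?addr0 => [|j ne_ji]; last first.
  by rewrite mxE (negbTE (contra_neq (@val_inj _ _ _ j i) ne_ji)) mulr0.
by have [lt_ik|/c0 ->] := ltnP i k; rewrite ?mulr1 ?mul0r.
Qed.

(** * Cartan's test *)

Section WebSystem.
Variable R : fieldType.
Implicit Types (r h : nat -> R) (u v w : tvec R cof unk).
Local Notation T := (@web_cof_d R).
Local Notation G := (@web_equations R).
Local Notation generator := (generator T G).

(* The unknown functions in terms of the principal ones, which are, in this
   order, a_1, p_11, p_12, q_11, q_12, b^1_111, b^2_111, b^2_211, b^2_122. *)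
Definition reduced_opt r (y : unk) : option R :=
  match y with
  | inl (inl (inl i)) => if i == 0 then Some (r 0%N) else None
  | inl (inl (inr (i, j))) =>
      if i == 0 then Some (if j == 0 then r 1%N else r 2%N) else None
  | inl (inr (i, j)) =>
      if i == 0 then Some (if j == 0 then r 3%N else r 4%N) else None
  | inr (i, j, k, l) =>
      if i == 0 then
        if [&& j == 0, k == 0 & l == 0] then Some (r 5%N) else None
      else if j == 0 then
        Some (if k == 0 then if l == 0 then r 6%N else r 7%N + r 1%N
              else if l == 0 then r 7%N + r 3%N else r 8%N)
      else
        if k == 0 then Some (if l == 0 then r 7%N else r 8%N - r 4%N)
        else if l == 0 then Some (r 8%N - r 2%N) else None
  end.

Definition cof_index (c : cof) : nat :=
  match c with
  | inl (inl i) => if i == 0 then 0%N else 1%N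
  | inl (inr i) => if i == 0 then 2%N else 3%N
  | inr None => 4%N
  | inr (Some i) => if i == 0 then 5%N else 6%N
  end.

Definition opt_vec h r (x : cof + unk) : option R :=
  match x with inl c => Some (h (cof_index c)) | inr y => reduced_opt r y end.

Definition reduced r y : R := odflt 0 (reduced_opt r y).

Definition principal (n : nat) : unk :=
  match n with
  | 0 => inl (inl (inl 0))
  | 1 => inl (inl (inr (0, 0)))
  | 2 => inl (inl (inr (0, 1)))
  | 3 => inl (inr (0, 0))
  | 4 => inl (inr (0, 1))
  | 5 => inr (0, 0, 0, 0)
  | 6 => inr (1, 0, 0, 0)
  | 7 => inr (1, 1, 0, 0)
  | _ => inr (1, 0, 1, 1)
  end.

Definition cof_at (n : nat) : cof :=
  match n with
  | 0 => inl (inl 0)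
  | 1 => inl (inl 1)
  | 2 => inl (inr 0)
  | 3 => inl (inr 1)
  | 4 => inr None
  | 5 => inr (Some 0)
  | _ => inr (Some 1)
  end.

(** * The algebraic relations between the unknown functions *)

Lemma unk_ind (P : unk -> Prop) :
    (forall i, P (inl (inl (inl i)))) ->
    (forall i j, P (inl (inl (inr (i, j))))) ->
    (forall i j, P (inl (inr (i, j)))) ->
    (forall i j k l, P (inr (i, j, k, l))) ->
  forall y, P y.
Proof. by move=> Pa Pp Pq Pb [[[i|[i j]]|[i j]]|[[[i j] k] l]]. Qed.

Definition dz (v : tvec R cof unk) y : R := v (inr y).
Definition eta (v : tvec R cof unk) n : R := v (inl (cof_at n)).

(** The equations of degree 0. They are linear, homogeneous and with constant coefficients, so the
    differentials of the unknowns satisfy the same relations as the unknowns themselves. *)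
Inductive zero_relation : fexpr R cof unk -> Prop :=
| zr_a2 : zero_relation (fa R 1)
| zr_hexagonal : zero_relation (fb R 1 1 1 1)
| zr_bp i j k l : zero_relation
    (FSub (FSub (fb R i j l k) (fb R i k l j))
          (FSub (FMul (kron R i k) (fp R j l)) (FMul (kron R i j) (fp R k l))))
| zr_bq i j k l : zero_relation
    (FSub (FSub (fb R i j k l) (fb R i k j l))
          (FSub (FMul (kron R i k) (fq R j l)) (FMul (kron R i j) (fq R k l))))
| zr_p2 i : zero_relation (fp R 1 i)
| zr_q2 i : zero_relation (fq R 1 i)
| zr_b12 k l : zero_relation (fb R 0 1 k l).

Lemma zero_relation_eq e : zero_relation e -> web_equations e.
Proof. by case; constructor. Qed.

Lemma zero_relation_deg e : zero_relation e -> fdeg e = 0%N.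
Proof. by case. Qed.

Lemma zero_relation_fd z v e : zero_relation e ->
  feval z (fd T e) [:: v] = feval (dz v) e [::].
Proof. rewrite /dz; case=> //=; intros; ring. Qed.

(** Reads an equation off a linear relation [t = 0] of any shape: [ring] then checks [x - y = t]. *)
Lemma eq_of_zero (x y t : R) : t = 0 -> x - y = t -> x = y.
Proof. by move=> -> /subr0_eq. Qed.

(** Solves the linear system for 26 unknowns in terms of the nine principal ones. It is applied to
    the unknowns and, through [zero_relation_fd], to their differentials. *)
Lemma zero_relationsP (f : unk -> R) :
  (forall e, zero_relation e -> feval f e [::] = 0) <->
  f =1 reduced (fun n => f (principal n)).
Proof.
split=> [f0|f0].
  have a2 := f0 _ zr_a2; have hx := f0 _ zr_hexagonal.
  have p2 i := f0 _ (zr_p2 i); have q2 i := f0 _ (zr_q2 i).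
  have b12 k l := f0 _ (zr_b12 k l).
  (* These relations alternate in [j] and [k], so only the pair (0, 1) carries information. *)
  have bp i l := f0 _ (zr_bp i 0 1 l); have bq i l := f0 _ (zr_bq i 0 1 l).
  have bp0 := bp 0; have bp1 := bp 1; have bq0 := bq 0; have bq1 := bq 1.
  move: a2 hx p2 q2 b12 bp0 bp1 bq0 bq1 => /= a2 hx p2 q2 b12 bp0 bp1 bq0 bq1.
  elim/unk_ind.
  - by elim/ord2_ind.
  - by elim/ord2_ind => //; elim/ord2_ind.
  - by elim/ord2_ind => //; elim/ord2_ind.
  - elim/ord2_ind => j k l.
      elim/ord2_ind: j; last by rewrite b12.
      have b01 l' : f (inr (0, 0, l', 1)) = 0.
        by apply: (eq_of_zero (bp0 l')); rewrite b12 p2; ring.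
      have b10 l' : f (inr (0, 0, 1, l')) = 0.
        by apply: (eq_of_zero (bq0 l')); rewrite b12 q2; ring.
      by elim/ord2_ind: k; elim/ord2_ind: l.
    have b0_1 l' : f (inr (1, 0, l', 1))
      = f (inr (1, 1, l', 0)) + f (inl (inl (inr (0, l')))).
      by apply: (eq_of_zero (bp1 l')); ring.
    have b01_ l' : f (inr (1, 0, 1, l'))
      = f (inr (1, 1, 0, l')) + f (inl (inr (0, l'))).
      by apply: (eq_of_zero (bq1 l')); ring.
    elim/ord2_ind: j; elim/ord2_ind: k; elim/ord2_ind: l => //; rewrite /reduced /=.
    + by rewrite b01_ addrK.
    + by rewrite b0_1 addrK.
move=> e; case=> [||i j k l|i j k l|i|i|k l] /=; rewrite !f0 //.
- elim/ord2_ind: i; elim/ord2_ind: j; elim/ord2_ind: k; elim/ord2_ind: l;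
    rewrite /reduced /=; ring.
- elim/ord2_ind: i; elim/ord2_ind: j; elim/ord2_ind: k; elim/ord2_ind: l;
    rewrite /reduced /=; ring.
Qed.

(** * The generators of the ideal on admissible vectors *)

Definition da_form i : fexpr R cof unk :=
  FSub (FSub (fd T (fa R i)) (FSum2 (fun j => FMul (fa R j) (om R i j))))
    (FAdd (FSum2 (fun j => FMul (fp R i j) (w1 R j)))
          (FSum2 (fun j => FMul (fq R i j) (w2 R j)))).

Lemma relation_gen (P : fexpr R cof unk -> Prop) :
    (forall e, zero_relation e -> P e) ->
    (forall j i, P (FSub (fd T (om R j i)) (dom R j i))) ->
    (forall i, P (da_form i)) ->
  forall e, web_equations e -> P e.
Proof.
move=> P0 Pdom Pda e.
by case=> *; (try exact: Pdom); (try exact: Pda); apply: P0; constructor.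
Qed.

(** The shape of the vectors killed by the 1-forms of the ideal: [h] gives the values of the
    coframe, [q] those of the differentials of the principal unknowns after a_1, and da_1 is
    prescribed by its structure equation. *)
Definition adm_vec r h q :=
  opt_vec h (fun n => if n is 0 then
    r 0%N * h 4%N + r 1%N * h 0%N + r 2%N * h 1%N + r 3%N * h 2%N + r 4%N * h 3%N
  else q n).

Definition admissible r v := exists h q, v = ovec (adm_vec r h q).

Lemma web_cof_deg c : (fdeg (T c) <= 2)%N.
Proof.
by case: c => [[]|[]]; try (by elim/ord2_ind).
Qed.

Lemma web_cof_nil z c : feval z (T c) [::] = 0.
Proof.
by case: c => [[]|[]]; try (elim/ord2_ind; rewrite /=; ring); rewrite /=; ring.
Qed.

Lemma gen_deg e : generator e -> (fdeg e <= 3)%N.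
Proof.
have web_deg (e' : fexpr R cof unk) : web_equations e' -> (fdeg e' <= 2)%N.
  move: e'; apply: (@relation_gen (fun e => fdeg e <= 2)%N) =>
    [e0 /zero_relation_deg -> //||].
    by elim/ord2_ind; elim/ord2_ind.
  by elim/ord2_ind.
have fd_deg (e' : fexpr R cof unk) : (fdeg e' <= 2)%N -> (fdeg (fd T e') <= 3)%N.
  by move=> le2; apply: leq_trans (fdeg_fd _ web_cof_deg) _.
case=> {e} [e /web_deg/leqW //|e /web_deg/fd_deg //|c].
by apply: fd_deg; apply: web_cof_deg.
Qed.

Lemma gen_nil z e : (forall e, zero_relation e -> feval z e [::] = 0) ->
  generator e -> feval z e [::] = 0.
Proof.
move=> z0; case: e / => [e|e _|c]; last 2 first.
- by apply: feval_fd_nil; apply: web_cof_nil.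
- by apply: feval_fd_nil; apply: web_cof_nil.
move: e; apply: (@relation_gen (fun e => feval z e [::] = 0)) => [e0 /z0 //||].
  elim/ord2_ind; elim/ord2_ind; rewrite /=; ring.
elim/ord2_ind; rewrite /=; ring.
Qed.

Definition dd_form c := fd T (T c).

(** The generators that do not vanish by themselves on admissible vectors: the differential of the
    equation for da_1, and the conditions d d = 0 on omega_1^1, omega_1^2 and omega_2^2. *)
Definition phi0 z u v : R := feval z (fd T (da_form 0)) [:: u; v].
Definition phi1 z u v w : R := feval z (dd_form (inr None)) [:: u; v; w].
Definition phi2 z u v w : R := feval z (dd_form (inr (Some 0))) [:: u; v; w].
Definition phi3 z u v w : R := feval z (dd_form (inr (Some 1))) [:: u; v; w].

(* The values of the differentials of the principal unknowns (rows) on the vectors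
   dual to the coframe (columns), for one integral element; the row of a_1 is the
   same for all of them. *)
Definition torsion_coef r n x : R :=
  let a := r 0%N in let p1 := r 1%N in let p2 := r 2%N in let q1 := r 3%N in
  let q2 := r 4%N in let be := r 5%N in let B := r 6%N in let C := r 7%N in
  let D := r 8%N in
  nth 0 (nth [::] [::
    [:: p1; p2; q1; q2; a; 0; 0];
    [:: 0; 0; 0; 0; 2 * p1; p2; 0];
    [:: - (a * p2); 0; 0; 0; p2; 0; p2];
    [:: - (a * be); 0; 0; 0; 2 * q1; q2; 0];
    [:: 0; 0; a * q2; 0; q2; 0; q2];
    [:: 0; 0; 0; 0; 2 * be; 0; 0];
    [:: 0; a * (C + q1) - a * be; 0; - (a * (C + p1));
        3 * B; 3 * C + p1 + q1 - be; - B];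
    [:: 0; 0; 0; 0; 2 * C; 2 * D - p2 - q2; 0];
    [:: - (a * D); 0; a * D; 0; D; 0; D]] n) x.

Definition sum7 (F : nat -> R) : R :=
  F 0%N + F 1%N + F 2%N + F 3%N + F 4%N + F 5%N + F 6%N.

(** The value on [v] of the form pi of the [n]-th principal unknown. For [n = 0] its vanishing is
    the equation for da_1. *)
Definition dev r v n : R :=
  dz v (principal n) - sum7 (fun x => torsion_coef r n x * eta v x).

Definition alt2 (A : Type) (f g : A -> R) (u v : A) := f u * g v - f v * g u.
Definition alt3 (A : Type) (f g h : A -> R) (u v w : A) :=
  f u * alt2 g h v w - f v * alt2 g h u w + f w * alt2 g h u v.

Local Notation et n := (fun v => eta v n).
Local Notation pv r n := (fun v => dev r v n).

Lemma eta_ovec (u : cof + unk -> option R) n :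
  eta (ovec u) n = odflt 0 (u (inl (cof_at n))).
Proof. by rewrite /eta ffunE. Qed.

Lemma dz_ovec (u : cof + unk -> option R) y : dz (ovec u) y = odflt 0 (u (inr y)).
Proof. by rewrite /dz ffunE. Qed.

Lemma dev_ovec r (u : cof + unk -> option R) n :
  dev r (ovec u) n = odflt 0 (u (inr (principal n)))
    - sum7 (fun x => torsion_coef r n x * odflt 0 (u (inl (cof_at x)))).
Proof. by rewrite /dev /sum7 !eta_ovec dz_ovec. Qed.

(** Here and in the next three lemmas [torsion_coef] absorbs all the torsion: every remaining term
    contains a factor [dev], so that the conditions on integral elements become linear and
    homogeneous in the deviations. *)
Lemma phi0E r u v : admissible r u -> admissible r v ->
  phi0 (reduced r) u v = alt2 (et 0) (pv r 1) u v + alt2 (et 1) (pv r 2) u v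
    + alt2 (et 2) (pv r 3) u v + alt2 (et 3) (pv r 4) u v.
Proof.
move=> [h1 [q1 ->]] [h2 [q2 ->]].
rewrite /alt2 !eta_ovec !dev_ovec /sum7 /torsion_coef /phi0 feval2E /=.
ring.
Qed.

Lemma phi1E r u v w : admissible r u -> admissible r v -> admissible r w ->
  phi1 (reduced r) u v w = alt3 (et 0) (et 2) (pv r 5) u v w.
Proof.
move=> [h1 [q1 ->]] [h2 [q2 ->]] [h3 [q3 ->]].
rewrite /alt3 /alt2 !eta_ovec !dev_ovec /sum7 /torsion_coef /phi1 feval3E /=.
ring.
Qed.

Lemma phi2E r u v w : admissible r u -> admissible r v -> admissible r w ->
  phi2 (reduced r) u v w = alt3 (et 0) (et 2) (pv r 6) u v w
    + alt3 (et 0) (et 3) (fun v => dev r v 1 + dev r v 7) u v w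
    + alt3 (et 1) (et 2) (fun v => dev r v 3 + dev r v 7) u v w
    + alt3 (et 1) (et 3) (pv r 8) u v w.
Proof.
move=> [h1 [q1 ->]] [h2 [q2 ->]] [h3 [q3 ->]].
rewrite /alt3 /alt2 !eta_ovec !dev_ovec /sum7 /torsion_coef /phi2 feval3E /=.
ring.
Qed.

Lemma phi3E r u v w : admissible r u -> admissible r v -> admissible r w ->
  phi3 (reduced r) u v w = alt3 (et 0) (et 2) (pv r 7) u v w
    + alt3 (et 0) (et 3) (fun v => dev r v 8 - dev r v 4) u v w
    + alt3 (et 1) (et 2) (fun v => dev r v 8 - dev r v 2) u v w.
Proof.
move=> [h1 [q1 ->]] [h2 [q2 ->]] [h3 [q3 ->]].
rewrite /alt3 /alt2 !eta_ovec !dev_ovec /sum7 /torsion_coef /phi3 feval3E /=.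
ring.
Qed.

Lemma zero_relation_reduced r e : zero_relation e -> feval (reduced r) e [::] = 0.
Proof.
apply: (iffRL (zero_relationsP _)).
by elim/unk_ind; do ![elim/ord2_ind].
Qed.

Lemma admissible_zero_relation r v e : admissible r v -> zero_relation e ->
  feval (reduced r) (fd T e) [:: v] = 0.
Proof.
move=> [h [q ->]] e0; rewrite (zero_relation_fd _ _ e0).
apply: (iffRL (zero_relationsP _)) e0.
by elim/unk_ind; do ![elim/ord2_ind]; rewrite /reduced /= /dz !ffunE.
Qed.

(** Generators have degree at most 3, so sequences of at most three vectors matter. On admissible
    vectors each generator then either vanishes by computation or is one of the four forms [phi0] to
    [phi3]. *)
Lemma gen_vanish r e s :
    generator e -> (forall v, v \in s -> admissible r v) ->
    (forall u v, s = [:: u; v] -> phi0 (reduced r) u v = 0) ->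
    (forall u v w, s = [:: u; v; w] ->
       [/\ phi1 (reduced r) u v w = 0, phi2 (reduced r) u v w = 0
         & phi3 (reduced r) u v w = 0]) ->
  feval (reduced r) e s = 0.
Proof.
move=> Ge adms Phi0 Phi3.
have [lt3|le3] := ltnP 3 (size s).
  by apply: feval_deg; apply: leq_ltn_trans (gen_deg Ge) lt3.
case: s adms Phi0 Phi3 le3 => [|u [|v [|w [|]]]] // adms Phi0 Phi3 _.
- by apply: gen_nil => // *; apply: zero_relation_reduced.
- have [h [q ->]] := adms u (mem_head _ _).
  move: Ge => [] {}e.
  + move: e; apply: (@relation_gen (fun e =>
      feval (reduced r) e [:: ovec (adm_vec r h q)] = 0)).
    * by move=> e /zero_relation_deg e0; apply: feval_deg; rewrite e0.
    * by do ![elim/ord2_ind]; rewrite feval1E /=; ring.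
    * by do ![elim/ord2_ind]; rewrite feval1E /=; ring.
  + move: e; apply: (@relation_gen (fun e =>
      feval (reduced r) (fd T e) [:: ovec (adm_vec r h q)] = 0)).
    * by move=> e; apply: admissible_zero_relation; exists h, q.
    * by do ![elim/ord2_ind]; rewrite feval1E /=; ring.
    * by do ![elim/ord2_ind]; rewrite feval1E /=; ring.
  + by case: e => [[]|[]]; do ?[elim/ord2_ind]; rewrite feval1E /=; ring.
- have := Phi0 _ _ erefl.
  have [h [q ->]] := adms u (mem_head _ _).
  have [|h' [q' ->]] := adms v _; first by rewrite !inE eqxx orbT.
  move=> {adms Phi0 Phi3} Phi0; move: Ge => [] {}e.
  + move: e; apply: (@relation_gen (fun e =>
      feval (reduced r) e [:: ovec (adm_vec r h q); ovec (adm_vec r h' q')] = 0)).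
    * by move=> e /zero_relation_deg e0; apply: feval_deg; rewrite e0.
    * by do ![elim/ord2_ind]; rewrite feval2E /=; ring.
    * by do ![elim/ord2_ind]; rewrite feval2E /=; ring.
  + move: e; apply: (@relation_gen (fun e =>
      feval (reduced r) (fd T e) [:: ovec (adm_vec r h q);
      ovec (adm_vec r h' q')] = 0)).
    * by move=> e /zero_relation_deg e0; apply: feval_deg;
        apply: leq_ltn_trans (fdeg_fd _ web_cof_deg) _; rewrite e0.
    * by do ![elim/ord2_ind]; rewrite feval2E /=; ring.
    * by elim/ord2_ind => //; rewrite feval2E /=; ring.
  + by case: e => [[]|[]]; do ?[elim/ord2_ind]; rewrite feval2E /=; ring.
have := Phi3 _ _ _ erefl.
have [h [q ->]] := adms u (mem_head _ _).
have [|h' [q' ->]] := adms v _; first by rewrite !inE eqxx orbT.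
have [|g [k ->]] := adms w _; first by rewrite !inE eqxx !orbT.
move=> {adms Phi0 Phi3} [Phi1 Phi2 Phi3]; move: Ge => [] {}e.
- move=> eP; apply: feval_deg; move: e eP.
  apply: (@relation_gen (fun e => fdeg e < 3)%N) => [e /zero_relation_deg -> //||].
    by do ![elim/ord2_ind].
  by elim/ord2_ind.
- move: e; apply: (@relation_gen (fun e =>
    feval (reduced r) (fd T e) [:: ovec (adm_vec r h q); ovec (adm_vec r h' q');
    ovec (adm_vec r g k)] = 0)).
  * by move=> e /zero_relation_deg e0; apply: feval_deg;
      apply: leq_ltn_trans (fdeg_fd _ web_cof_deg) _; rewrite e0.
  * by do ![elim/ord2_ind]; rewrite feval3E /=; ring.
  * by do ![elim/ord2_ind]; rewrite feval3E /=; ring.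
(* For the forms omega_(1)^i and omega_(2)^i, d d = 0 is a first Bianchi identity, already contained
   in the relations solved by [reduced]; for the three connection forms it is a hypothesis. *)
- by case: e => [[]|[]]; do ?[elim/ord2_ind] => //; rewrite feval3E /=; ring.
Qed.

(** * Integral elements and polar spaces described by the four forms *)

Lemma cof_indexK : cancel cof_index cof_at.
Proof. by move=> [[i|i]|[i|]] //; elim/ord2_ind: i. Qed.

Lemma cof_atK n : (n < 7)%N -> cof_index (cof_at n) = n.
Proof. by do 7?[case: n => [//|n]]. Qed.

Lemma reduced_eq r r' y : (forall n, (n < 9)%N -> r n = r' n) ->
  reduced r y = reduced r' y.
Proof.
move=> e; rewrite /reduced; elim/unk_ind: y; do ![elim/ord2_ind]; by rewrite //= ?e.
Qed.

Lemma reduced_lin k r r' y :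
  reduced (fun n => k * r n + r' n) y = k * reduced r y + reduced r' y.
Proof. by elim/unk_ind: y; do ![elim/ord2_ind]; rewrite /reduced /=; ring. Qed.

Lemma reduced_principal r n : (n < 9)%N -> reduced r (principal n) = r n.
Proof. by do 9?[case: n => [//|n]]. Qed.

Lemma sum_cof (F : cof -> R) : \sum_x F x = sum7 (fun n => F (cof_at n)).
Proof.
have [g gK Kg] : bijective (fun n : 'I_7 => cof_at n).
  exists (fun x => inord (cof_index x)) => [n|x].
    by rewrite cof_atK ?ltn_ord // inord_val.
  rewrite inordK ?cof_indexK //.
  by move: x => [[i|i]|[i|]] //; elim/ord2_ind: i.
rewrite (reindex (fun n : 'I_7 => cof_at n)) /=; last by exists g => n _;
  [apply: gK|apply: Kg].
by rewrite /sum7 !big_ord_recr big_ord0 /= add0r.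
Qed.

Lemma reduced_sum7 (F : nat -> nat -> R) (h : nat -> R) y :
  sum7 (fun x => reduced (F^~ x) y * h x)
    = reduced (fun n => sum7 (fun x => F n x * h x)) y.
Proof. by elim/unk_ind: y; do ![elim/ord2_ind]; rewrite /sum7 /reduced /=; ring. Qed.

Lemma admissibleP r v : admissible r v <->
  dz v =1 reduced (fun n => dz v (principal n)) /\ dev r v 0 = 0.
Proof.
split=> [[h [q ->]]|[dzv piv0]].
  split; last by rewrite dev_ovec /sum7 /torsion_coef /=; ring.
  by elim/unk_ind; do ![elim/ord2_ind]; rewrite /reduced /= !dz_ovec.
exists (eta v), (fun n => dz v (principal n)); apply/ffunP => -[c|y]; rewrite ffunE.
  by rewrite /= /eta cof_indexK.
have := dzv y; rewrite {1}/dz => ->; apply: reduced_eq => -[|n] // _.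
by move/subr0_eq: piv0 => ->; rewrite /sum7 /torsion_coef /=; ring.
Qed.

Lemma admissible_gen r v :
  (forall e, generator e -> feval (reduced r) e [:: v] = 0) -> admissible r v.
Proof.
move=> v0; apply/admissibleP; split.
  apply/zero_relationsP => e e0; rewrite -(zero_relation_fd (reduced r) _ e0).
  by apply: v0; apply: gen_dform; apply: zero_relation_eq.
have /= := v0 _ (gen_form _ (we_da R 0)).
by move=> da0; apply: (eq_of_zero da0);
  rewrite /dev /sum7 /torsion_coef /dz /eta /= /reduced /=; ring.
Qed.

Lemma integral_elementP r E : integral_element T G (reduced r) E <->
  [/\ forall v, E v -> admissible r v,
      forall u v, E u -> E v -> phi0 (reduced r) u v = 0
    & forall u v w, E u -> E v -> E w ->
        [/\ phi1 (reduced r) u v w = 0, phi2 (reduced r) u v w = 0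
          & phi3 (reduced r) u v w = 0]].
Proof.
have dda0 : generator (fd T (da_form 0)) by apply: gen_dform; apply: we_da.
split=> [intE|[admE E0 E3] e Ge s sE]; last first.
  apply: gen_vanish => // [v /sE/admE //|u v s2|u v w s3].
    by apply: E0; apply: sE; rewrite s2 !inE eqxx ?orbT.
  by apply: E3; apply: sE; rewrite s3 !inE eqxx ?orbT.
split=> [v Ev|u v Eu Ev|u v w Eu Ev Ew].
- by apply: admissible_gen => e Ge; apply: intE => // w; rewrite inE => /eqP->.
- by apply: intE => // w; rewrite !inE => /orP[]/eqP->.
- by split; apply: intE; (try exact: gen_ddcof) => x; rewrite !inE => /or3P[]/eqP->.
Qed.

Lemma polarP r (E : _ -> Prop) v : (forall u, E u -> admissible r u) ->
  polar T G (reduced r) E v <->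
  [/\ admissible r v, forall u, E u -> phi0 (reduced r) v u = 0
    & forall u w, E u -> E w ->
        [/\ phi1 (reduced r) v u w = 0, phi2 (reduced r) v u w = 0
          & phi3 (reduced r) v u w = 0]].
Proof.
have dda0 : generator (fd T (da_form 0)) by apply: gen_dform; apply: we_da.
move=> admE; split=> [polE|[admv E0 E3] e Ge s sE]; last first.
  apply: gen_vanish => // [u|u w [<- s1]|u w x [<- s2]].
  - by rewrite inE => /predU1P[->|/sE/admE].
  - by apply: E0; apply: sE; rewrite s1 !inE eqxx ?orbT.
  - by apply: E3; apply: sE; rewrite s2 !inE eqxx ?orbT.
split=> [|u Eu|u w Eu Ew].
- by apply: admissible_gen => e Ge; apply: polE.
- by apply: polE => // w; rewrite !inE => /eqP->.
- by split; apply: polE; (try exact: gen_ddcof) => x; rewrite !inE => /orP[]/eqP->.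
Qed.

(** * The affine space of integral elements *)

Definition graph_mx coef : {ffun unk * cof -> R^o} :=
  [ffun yx => reduced (coef^~ (cof_index yx.2)) yx.1].

Lemma graph_mxP coef v : graph (graph_mx coef) v <->
  dz v =1 reduced (fun n => sum7 (fun x => coef n x * eta v x)).
Proof.
have E y : \sum_x graph_mx coef (y, x) * v (inl x)
    = reduced (fun n => sum7 (fun x => coef n x * eta v x)) y.
  rewrite -reduced_sum7 sum_cof /sum7.
  by rewrite !ffunE /=.
by split=> gv y; [rewrite -E; apply: gv | rewrite E; apply: gv].
Qed.

Lemma graph_torsionP r v : graph (graph_mx (torsion_coef r)) v <->
  admissible r v /\ forall n, (0 < n < 9)%N -> dev r v n = 0.
Proof.
rewrite graph_mxP admissibleP; split=> [gv|[[admv piv0] piv1] y].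
  have dzn n : (n < 9)%N ->
    dz v (principal n) = sum7 (fun x => torsion_coef r n x * eta v x).
    by move=> lt_n9; rewrite gv reduced_principal.
  have pivn n : (n < 9)%N -> dev r v n = 0 by move=> /dzn e; rewrite /dev e subrr.
  split; last by move=> n /andP[_]; apply: pivn.
  by split; [move=> y; rewrite gv; apply: reduced_eq => n /dzn -> | apply: pivn].
rewrite admv; apply: reduced_eq => -[_|n lt_n9]; first exact/subr0_eq.
by apply/subr0_eq/piv1.
Qed.

(* The general solution of the homogeneous linear equations satisfied by the
   difference of two integral elements. *)
Definition free_coef (t : 'rV[R]_18) (n x : nat) : R :=
  let t i := t 0 (inord i) in
  nth 0 (nth [::] [::
    [::];
    [:: t 0%N; t 1%N; t 2%N; t 3%N];
    [:: t 1%N; t 4%N; t 5%N; t 6%N];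
    [:: t 2%N; t 5%N; t 7%N; t 8%N];
    [:: t 3%N; t 6%N; t 8%N; t 9%N];
    [:: t 10%N; 0; t 11%N; 0];
    [:: t 12%N; t 2%N + t 14%N; t 13%N; t 2%N + t 16%N];
    [:: t 14%N; t 15%N; t 16%N; t 17%N];
    [:: t 15%N + t 1%N; t 6%N; t 17%N + t 8%N; t 6%N]] n) x.

Lemma dev_free r t v n : (0 < n < 9)%N ->
  graph (graph_mx (fun n x => torsion_coef r n x + free_coef t n x)) v ->
  dev r v n = sum7 (fun x => free_coef t n x * eta v x).
Proof.
move=> /andP[n0 lt_n9] /graph_mxP gv; rewrite /dev gv reduced_principal // /sum7;
  ring.
Qed.

Lemma free_integral r t :
  integral_element T G (reduced r)
    (graph (graph_mx (fun n x => torsion_coef r n x + free_coef t n x))).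
Proof.
have adml v :
    graph (graph_mx (fun n x => torsion_coef r n x + free_coef t n x)) v ->
  admissible r v.
  move=> /graph_mxP gv; apply/admissibleP; split.
    by move=> y; rewrite gv; apply: reduced_eq => n lt_n9;
      rewrite gv reduced_principal.
  by rewrite /dev gv reduced_principal // /sum7 /free_coef /=; ring.
apply/integral_elementP; split=> // [u v gu gv|u v w gu gv gw].
  rewrite phi0E /alt2; try exact: adml.
  by rewrite !(dev_free _ gu) ?(dev_free _ gv) // /sum7 /free_coef /=; ring.
have [au [av aw]] := conj (adml _ gu) (conj (adml _ gv) (adml _ gw)).
rewrite phi1E ?phi2E ?phi3E // /alt3 /alt2.
rewrite !(dev_free _ gu) ?(dev_free _ gv) ?(dev_free _ gw) // /sum7 /free_coef /=.
by split; ring.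
Qed.

Definition basis_vec (p : {ffun unk * cof -> R^o}) (n : nat) : tvec R cof unk :=
  [ffun i => match i with
   | inl x => (cof_index x == n)%:R
   | inr y => p (y, cof_at n)
   end].

Lemma eta_basis p n m : (m < 7)%N -> eta (basis_vec p n) m = (m == n)%:R.
Proof. by move=> lt_m7; rewrite /eta ffunE cof_atK. Qed.

Lemma dz_basis p n y : dz (basis_vec p n) y = p (y, cof_at n).
Proof. by rewrite /dz ffunE. Qed.

Lemma sum7_basis F p n : (n < 7)%N ->
  sum7 (fun x => F x * eta (basis_vec p n) x) = F n.
Proof.
by rewrite /sum7 !eta_basis //; do 7?[case: n => [_|n]] => //=; ring.
Qed.

Lemma graph_basis p n : (n < 7)%N -> graph p (basis_vec p n).
Proof.
move=> lt_n7 y; rewrite sum_cof.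
rewrite -/(dz _ _) dz_basis.
exact: esym (sum7_basis (fun m => p (y, cof_at m)) p lt_n7).
Qed.

(** By Cartan's lemma [phi0] makes rows 1 to 4 of the deviations a symmetric 4 x 4 matrix, with 10
    parameters. The 3-forms then leave 2 parameters in row 5, 2 in row 6 and 4 in row 7, and
    determine row 8: 18 in all. *)
Lemma integral_free r p : integral_element T G (reduced r) (graph p) ->
  exists t, p = graph_mx (fun n x => torsion_coef r n x + free_coef t n x).
Proof.
move=> /integral_elementP[admp int0 int3].
have gp n : (n < 7)%N -> graph p (basis_vec p n) by exact: graph_basis.
have adg n : (n < 7)%N -> admissible r (basis_vec p n) by move/gp/admp.
pose dl n x := dev r (basis_vec p x) n.
pose e (n x : nat) : R := (n == x)%:R.
have eb n x : (n < 7)%N -> eta (basis_vec p x) n = e n x by apply: eta_basis.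
have E0 i j (li : (i < 7)%N) (lj : (j < 7)%N) :
    alt2 (e 0) (dl 1) i j + alt2 (e 1) (dl 2) i j
    + alt2 (e 2) (dl 3) i j + alt2 (e 3) (dl 4) i j = 0 :> R.
  rewrite -(int0 _ _ (gp i li) (gp j lj)) phi0E; try exact: adg.
  by rewrite /alt2 !eb.
have E3 i j k (li : (i < 7)%N) (lj : (j < 7)%N) (lk : (k < 7)%N) :
  [/\ alt3 (e 0) (e 2) (dl 5) i j k = 0 :> R,
      alt3 (e 0) (e 2) (dl 6) i j k
      + alt3 (e 0) (e 3) (fun x => dl 1 x + dl 7 x) i j k
      + alt3 (e 1) (e 2) (fun x => dl 3 x + dl 7 x) i j k
      + alt3 (e 1) (e 3) (dl 8) i j k = 0 :> R
    & alt3 (e 0) (e 2) (dl 7) i j k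
      + alt3 (e 0) (e 3) (fun x => dl 8 x - dl 4 x) i j k
      + alt3 (e 1) (e 2) (fun x => dl 8 x - dl 2 x) i j k = 0 :> R].
  have [] := int3 _ _ _ (gp i li) (gp j lj) (gp k lk).
  rewrite phi1E ?phi2E ?phi3E; try exact: adg.
  by rewrite /alt3 /alt2 !eb // => -> -> ->.
(* Only the first four coframe forms are factors in the four forms, so the deviations have no
   component along the connection forms. *)
have dl4 n x : (0 < n < 9)%N -> (3 < x < 7)%N -> dl n x = 0.
  move=> /andP[n0 n9] /andP[x3 x7].
  have ex m : (m < 4)%N -> e m x = 0.
    by move=> m4; rewrite /e; case: eqP => // mx; move: m4 x3; rewrite mx; lia.
  have := E0 0 x isT x7; have := E0 1 x isT x7.
  have := E0 2 x isT x7; have := E0 3 x isT x7.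
  have := E3 0 2 x isT isT x7; have := E3 0 3 x isT isT x7.
  have := E3 1 3 x isT isT x7.
  rewrite /alt3 /alt2 !ex // /e /= => -[_ p8 _] [_ p17 _] [p5 p6 p7] p4 p3 p2 p1.
  have {}p1 : dl 1 x = 0 by apply: (eq_of_zero p1); ring.
  have {}p7 : dl 7 x = 0 by apply: (eq_of_zero p7); ring.
  case: n n0 n9 => [//|[|[|[|[|[|[|[|[|//]]]]]]]]] _ _ //.
  - by apply: (eq_of_zero p2); ring.
  - by apply: (eq_of_zero p3); ring.
  - by apply: (eq_of_zero p4); ring.
  - by apply: (eq_of_zero p5); ring.
  - by apply: (eq_of_zero p6); ring.
  - by apply: (eq_of_zero p8); ring.
have [+ + +] := E3 0 1 2 isT isT isT.
have [+ + +] := E3 0 1 3 isT isT isT.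
have [+ + +] := E3 0 2 3 isT isT isT.
have [+ + +] := E3 1 2 3 isT isT isT.
have := E0 0 1 isT isT; have := E0 0 2 isT isT; have := E0 0 3 isT isT.
have := E0 1 2 isT isT; have := E0 1 3 isT isT; have := E0 2 3 isT isT.
(* The letters q, p, b, c stand for [phi0], [phi1], [phi2], [phi3], and the digits for the basis
   vectors inserted. *)
rewrite /alt3 /alt2 /e /= => q23 q13 q12 q03 q02 q01.
move=> _ b123 c123 p023 b023 c023 _ b013 c013 p012 b012 c012.
have e20 : dl 2 0 = dl 1 1 by apply/esym/(eq_of_zero q01); ring.
have e30 : dl 3 0 = dl 1 2 by apply/esym/(eq_of_zero q02); ring.
have e40 : dl 4 0 = dl 1 3 by apply/esym/(eq_of_zero q03); ring.
have e31 : dl 3 1 = dl 2 2 by apply/esym/(eq_of_zero q12); ring.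
have e41 : dl 4 1 = dl 2 3 by apply/esym/(eq_of_zero q13); ring.
have e42 : dl 4 2 = dl 3 3 by apply/esym/(eq_of_zero q23); ring.
have e51 : dl 5 1 = 0 by apply/esym/(eq_of_zero p012); ring.
have e53 : dl 5 3 = 0 by apply/(eq_of_zero p023); ring.
have e61 : dl 6 1 = dl 1 2 + dl 7 0.
  by apply/esym/(eq_of_zero b012); rewrite -e30; ring.
have e63 : dl 6 3 = dl 1 2 + dl 7 2 by apply/(eq_of_zero b023); ring.
have e80 : dl 8 0 = dl 7 1 + dl 1 1.
  by apply/(eq_of_zero b013); ring.
have e81 : dl 8 1 = dl 2 3.
  by apply/esym/(eq_of_zero c013); rewrite -e41; ring.
have e82 : dl 8 2 = dl 7 3 + dl 3 3.
  by apply/esym/(eq_of_zero b123); ring.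
have e83 : dl 8 3 = dl 2 3.
  by apply/(eq_of_zero c123); ring.
pose t : 'rV[R]_18 := \row_i nth 0 [:: dl 1 0; dl 1 1; dl 1 2; dl 1 3; dl 2 1;
  dl 2 2; dl 2 3; dl 3 2; dl 3 3; dl 4 3; dl 5 0; dl 5 2; dl 6 0; dl 6 2;
  dl 7 0; dl 7 1; dl 7 2; dl 7 3]%N i.
have dlE n x : (0 < n < 9)%N -> (x < 7)%N -> dl n x = free_coef t n x.
  move=> n9 x7; have [x3|x3] := ltnP 3 x.
    rewrite dl4 ?x3 // /free_coef.
    move: n9 x7 x3; do 9?[case: n => [//|n]] => // _;
      do 7?[case: x => [//|x]] => //.
  rewrite /free_coef; move: n9 x3 {x7}.
  case: n => [//|[|[|[|[|[|[|[|[|//]]]]]]]]] _; case: x => [|[|[|[|//]]]] _ /=;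
    rewrite ?mxE ?inordK //= ?(e20, e30, e40, e31, e41, e42, e51, e53, e61, e63,
      e80, e81, e82, e83) //.
exists t; apply/ffunP => -[y c]; rewrite ffunE /=.
have lt7 : (cof_index c < 7)%N by move: c => [[i|i]|[i|]] //; elim/ord2_ind: i.
have /admissibleP[] := adg _ lt7; move=> /(_ y);
  rewrite dz_basis cof_indexK => -> piv0.
apply: reduced_eq => n n9; case: n n9 => [_|n n9].
  (* Row 0 of [free_coef] is the empty list and reads as 0: da_1 is the same on all integral
     elements. *)
  have -> : free_coef t 0 (cof_index c) = 0 by rewrite /free_coef /= nth_nil.
  by rewrite addr0; move/subr0_eq: piv0 => ->; rewrite sum7_basis.
rewrite -dlE // /dl /dev sum7_basis //; ring.
Qed.

Lemma free_linear : linear (fun t => graph_mx (free_coef t)).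
Proof.
move=> k t t'; apply/ffunP => -[y c]; rewrite !ffunE /= -reduced_lin.
apply: reduced_eq => n n9; rewrite /free_coef.
have lt7 : (cof_index c < 7)%N by move: c => [[i|i]|[i|]] //; elim/ord2_ind: i.
move: (cof_index c) lt7 n9 => x.
case: n => [|[|[|[|[|[|[|[|[|//]]]]]]]]]; case: x => [|[|[|[|[|[|[|//]]]]]]] _ _ /=;
  rewrite ?mxE; ring.
Qed.

Lemma free_inj : injective (fun t => graph_mx (free_coef t)).
Proof.
move=> t t' e.
have {}e n x : (n < 9)%N -> (x < 7)%N -> free_coef t n x = free_coef t' n x.
  move=> n9 x7; move/ffunP: e => /(_ (principal n, cof_at x)); rewrite !ffunE /=.
  by rewrite !reduced_principal // cof_atK.
apply/rowP => i; rewrite -(inord_val i); case: i => [i lt_i18] /=.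
move: lt_i18; case: i => [|[|[|[|[|[|[|[|[|[|[|[|[|[|[|[|[|[|//]]]]]]]]]]]]]]]]]] _;
  [exact: (e 1 0)%N|exact: (e 1 1)%N|exact: (e 1 2)%N|exact: (e 1 3)%N
  |exact: (e 2 1)%N|exact: (e 2 2)%N|exact: (e 2 3)%N|exact: (e 3 2)%N
  |exact: (e 3 3)%N|exact: (e 4 3)%N|exact: (e 5 0)%N|exact: (e 5 2)%N
  |exact: (e 6 0)%N|exact: (e 6 2)%N|exact: (e 7 0)%N|exact: (e 7 1)%N
  |exact: (e 7 2)%N|exact: (e 7 3)%N].
Qed.

Lemma integral_affine r :
  exists2 L : {vspace {ffun unk * cof -> R^o}}, \dim L = 18 &
    forall p, integral_element T G (reduced r) (graph p) <->
      p - graph_mx (torsion_coef r) \in L.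
Proof.
have pmD t : graph_mx (fun n x => torsion_coef r n x + free_coef t n x)
    = graph_mx (torsion_coef r) + graph_mx (free_coef t).
  apply/ffunP => -[y c]; rewrite !ffunE /= -[X in X + _]mul1r -reduced_lin.
  by apply: reduced_eq => n _; rewrite mul1r.
pose f := GRing.isLinear.Build _ _ _ _ _ free_linear.
pose f' : {linear 'rV[R]_18 -> {ffun unk * cof -> R^o}} :=
  HB.pack (fun t => graph_mx (free_coef t)) f.
have [F FP] := flag_param (free_inj : injective f').
(* At [k = 18] no coordinate is constrained, and the member of the flag is the whole image. *)
have [dimF memF] := FP 18 (leqnn _).
exists (F 18) => // p; rewrite memF; split=> [/integral_free[t ->]|[t pE _]].
  exists t; first by rewrite pmD addrC addKr.
  by move=> i; rewrite leqNgt ltn_ord.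
by move/eqP: pE; rewrite subr_eq addrC => /eqP->; rewrite -pmD; apply: free_integral.
Qed.

(* Coordinates on the admissible vectors, such that the vanishing of all but the
   first k of them defines the space of dimension k of the flag, and also the polar
   spaces of these: the first seven are those of the projection to the coframe in
   the basis e_1, e_3, e_2 + e_4, e_4, ..., the others are values of [dev]. *)
Definition flag_eta (c : 'rV[R]_15) n : R :=
  let c i := c 0 (inord i) in
  nth 0 [:: c 0%N; c 2%N; c 1%N; c 2%N + c 3%N; c 4%N; c 5%N; c 6%N] n.

Definition flag_dev (c : 'rV[R]_15) n : R :=
  let c i := c 0 (inord i) in
  nth 0 [:: 0; c 14%N; c 7%N; c 10%N; c 8%N; c 11%N; c 12%N; c 13%N; c 9%N] n.

Definition flag_coord r v (i : nat) : R :=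
  nth 0 [:: eta v 0; eta v 2; eta v 1; eta v 3 - eta v 1; eta v 4; eta v 5;
    eta v 6; dev r v 2; dev r v 4; dev r v 8; dev r v 3; dev r v 5; dev r v 6;
    dev r v 7; dev r v 1] i.

Definition flag_vec r c : tvec R cof unk :=
  [ffun x => match x with
   | inl x => flag_eta c (cof_index x)
   | inr y => reduced (fun n =>
       flag_dev c n + sum7 (fun x => torsion_coef r n x * flag_eta c x)) y
   end].

Lemma flag_vec_linear r : linear (flag_vec r).
Proof.
move=> k c c'.
have eta_lin x : (x < 7)%N ->
  flag_eta (k *: c + c') x = k * flag_eta c x + flag_eta c' x.
  by rewrite /flag_eta; case: x => [|[|[|[|[|[|[|//]]]]]]] _ /=; rewrite !mxE; ring.
have pi_lin n : (n < 9)%N ->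
  flag_dev (k *: c + c') n = k * flag_dev c n + flag_dev c' n.
  by rewrite /flag_dev; case: n => [|[|[|[|[|[|[|[|[|//]]]]]]]]] _ /=;
    rewrite ?mxE; ring.
apply/ffunP => -[x|y]; rewrite !ffunE.
  by rewrite eta_lin //; move: x => [[i|i]|[i|]] //; elim/ord2_ind: i.
rewrite -reduced_lin; apply: reduced_eq => n n9;
  rewrite pi_lin // /sum7 !eta_lin //; ring.
Qed.

Lemma eta_flag r c n : (n < 7)%N -> eta (flag_vec r c) n = flag_eta c n.
Proof. by move=> n7; rewrite /eta ffunE cof_atK. Qed.

Lemma dev_flag r c n : (n < 9)%N -> dev r (flag_vec r c) n = flag_dev c n.
Proof.
move=> n9; rewrite /dev {1}/dz ffunE reduced_principal // /sum7 !eta_flag //; ring.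
Qed.

Lemma admissible_flag r c : admissible r (flag_vec r c).
Proof.
apply/admissibleP; split; last by rewrite dev_flag.
by move=> y; rewrite {1}/dz ffunE; apply: reduced_eq => n n9;
  rewrite /dz ffunE reduced_principal.
Qed.

Lemma coord_flag r c i : (i < 15)%N -> flag_coord r (flag_vec r c) i = c 0 (inord i).
Proof.
move=> i15; rewrite /flag_coord !eta_flag // !dev_flag // /flag_eta /flag_dev /=.
by move: i15; case: i => [|[|[|[|[|[|[|[|[|[|[|[|[|[|[|//]]]]]]]]]]]]]]] _ //=; ring.
Qed.

Lemma flag_vecK r v : admissible r v -> v = flag_vec r (\row_i flag_coord r v i).
Proof.
move=> /admissibleP[admv piv0].
have etaE n : (n < 7)%N -> flag_eta (\row_i flag_coord r v i) n = eta v n.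
  by rewrite /flag_eta; case: n => [|[|[|[|[|[|[|//]]]]]]] _ /=;
    rewrite !mxE !inordK //= /flag_coord /=; ring.
have pivE n : (n < 9)%N -> flag_dev (\row_i flag_coord r v i) n = dev r v n.
  by rewrite /flag_dev; case: n => [|[|[|[|[|[|[|[|[|//]]]]]]]]] _ /=;
    rewrite ?mxE ?inordK.
apply/ffunP => -[x|y]; rewrite !ffunE.
  rewrite etaE ?/eta ?cof_indexK //.
  by move: x => [[i|i]|[i|]] //; elim/ord2_ind: i.
have := admv y; rewrite {1}/dz => ->; apply: reduced_eq => n n9.
rewrite pivE // /dev /sum7 !etaE //; ring.
Qed.

Lemma flag_spaces r :
  exists F : nat -> {vspace tvec R cof unk}, forall k, (k <= 15)%N ->
    \dim (F k) = k /\ forall v, v \in F k <->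
      admissible r v /\ forall i, (k <= i < 15)%N -> flag_coord r v i = 0.
Proof.
pose f := GRing.isLinear.Build _ _ _ _ _ (flag_vec_linear r).
pose f' : {linear 'rV[R]_15 -> tvec R cof unk} := HB.pack (flag_vec r) f.
have f_inj : injective f'.
  move=> c c' e; apply/rowP => i; rewrite -(inord_val i).
  by rewrite -!(coord_flag r) // -[flag_vec r c]/(f' c) e.
have [F FP] := flag_param f_inj; exists F => k k15.
have [dimF memF] := FP k k15; split=> // v; rewrite memF; split.
  case=> c -> c0; split; first exact: admissible_flag.
  move=> i /andP[ki i15]; rewrite coord_flag //.
  by apply: c0; rewrite inordK.
case=> admv v0; exists (\row_i flag_coord r v i); first exact: flag_vecK.
by move=> i ki; rewrite mxE v0 // ki ltn_ord.
Qed.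

Hypothesis two_neq0 : 2 != 0 :> R.

(** * Polar spaces along the flag and the characters *)

Lemma card_cof : #|cof| = 7.
Proof. by rewrite !card_sum card_option !card_ord. Qed.

Lemma card_unk : #|unk| = 26.
Proof. by rewrite !card_sum !card_prod !card_ord. Qed.

(** The 18 conditions on admissible vectors are the 17 independent linear relations that reduce 26
    differentials to nine, and the equation for da_1. *)
Definition characters (k : nat) : nat := nth 0 [:: 18; 1; 4; 3] k.

(** It starts at 15 = 33 - 18, the dimension of the admissible vectors, and drops by 1, 4 and 3.
    From [k = 3] on it has the default value 7, the polar space being the reference integral
    element. *)
Definition polar_dim (k : nat) : nat := nth 7 [:: 15; 14; 10] k.

Lemma integral_torsion r :
  integral_element T G (reduced r) (graph (graph_mx (torsion_coef r))).
Proof.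
by have [L _ LP] := integral_affine r; apply/LP; rewrite subrr mem0v.
Qed.

Lemma integral_subset z E E' : (forall v, E v -> E' v) ->
  integral_element T G z E' -> integral_element T G z E.
Proof. by move=> sEE' intE' e Ge s sE; apply: intE' => // v /sE/sEE'. Qed.

Lemma graph_coord r v : graph (graph_mx (torsion_coef r)) v <->
  admissible r v /\ forall i, (7 <= i < 15)%N -> flag_coord r v i = 0.
Proof.
rewrite graph_torsionP; split=> -[admv v0]; split=> //.
  by case=> [|[|[|[|[|[|[|[|[|[|[|[|[|[|[|//]]]]]]]]]]]]]]] // _; apply: v0.
have c i : (7 <= i < 15)%N -> flag_coord r v i = 0 by apply: v0.
case=> [//|[|[|[|[|[|[|[|[|//]]]]]]]]] _;
  [exact: (c 14)|exact: (c 7)|exact: (c 10)|exact: (c 8)|exact: (c 11)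
  |exact: (c 12)|exact: (c 13)|exact: (c 9)].
Qed.

Lemma delta_coord i j : (i < 15)%N -> (j < 15)%N ->
  (delta_mx 0 (inord i) : 'rV[R]_15) 0 (inord j) = (j == i)%:R.
Proof. by move=> i15 j15; rewrite mxE eqxx -val_eqE /= !inordK. Qed.

(** The deviations vanish on [u] and [w], which lie in the reference integral element, so only the
    terms with the deviation taken on [v] survive. *)
Lemma graph_polar r v u w : admissible r v ->
    graph (graph_mx (torsion_coef r)) u -> graph (graph_mx (torsion_coef r)) w ->
  let m i j := alt2 (et i) (et j) u w in
  [/\ phi0 (reduced r) v u = - (eta u 0 * dev r v 1 + eta u 1 * dev r v 2
                          + eta u 2 * dev r v 3 + eta u 3 * dev r v 4),
      phi1 (reduced r) v u w = m 0%N 2%N * dev r v 5,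
      phi2 (reduced r) v u w
        = m 0%N 2%N * dev r v 6 + m 0%N 3%N * (dev r v 1 + dev r v 7)
        + m 1%N 2%N * (dev r v 3 + dev r v 7) + m 1%N 3%N * dev r v 8
    & phi3 (reduced r) v u w
      = m 0%N 2%N * dev r v 7 + m 0%N 3%N * (dev r v 8 - dev r v 4)
        + m 1%N 2%N * (dev r v 8 - dev r v 2)].
Proof.
move=> admv /graph_torsionP[admu pu] /graph_torsionP[admw pw] m.
rewrite (phi0E admv admu) (phi1E admv admu admw) (phi2E admv admu admw).
rewrite (phi3E admv admu admw) /m /alt3 /alt2.
rewrite !(pu 1 isT, pu 2 isT, pu 3 isT, pu 4 isT, pu 5 isT, pu 6 isT, pu 7 isT,
  pu 8 isT)%N.
rewrite !(pw 1 isT, pw 3 isT, pw 4 isT, pw 5 isT, pw 6 isT, pw 7 isT, pw 8 isT,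
  pw 2 isT)%N.
by split; ring.
Qed.

Section Polar.
Variables (r : nat -> R) (F : nat -> {vspace tvec R cof unk}).
Hypothesis memF : forall k, (k <= 15)%N -> forall v, v \in F k <->
  admissible r v /\ forall i, (k <= i < 15)%N -> flag_coord r v i = 0.

Lemma F_graph k u : (k <= 7)%N -> u \in F k -> graph (graph_mx (torsion_coef r)) u.
Proof.
move=> k7; rewrite memF ?(leq_trans k7) // => -[admu u0].
apply/graph_coord; split=> // i /andP[i7 i15].
by apply: u0; rewrite (leq_trans k7).
Qed.

(** The vectors e_1, e_3 and e_2 + e_4 that span the first three spaces of the flag, obtained from
    unit rows of coordinates. *)
Lemma flag_basis_ex i : (i < 3)%N ->
  let e := nth 0
    (nth [::] [:: [:: 1; 0; 0; 0]; [:: 0; 0; 1; 0]; [:: 0; 1; 0; 1]] i) in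
  exists b, (forall k, (i < k)%N -> (k <= 15)%N -> b \in F k) /\
    [/\ eta b 0 = e 0%N, eta b 1 = e 1%N, eta b 2 = e 2%N & eta b 3 = e 3%N].
Proof.
move=> i3 e; exists (flag_vec r (delta_mx 0 (inord i))); split=> [k ik k15|].
  apply/memF => //; split=> [|j /andP[kj j15]]; first exact: admissible_flag.
  by rewrite coord_flag // delta_coord // ?(leq_trans ik) // gtn_eqF //
    (leq_trans ik).
rewrite !eta_flag // /flag_eta /e.
by case: i i3 {e} => [|[|[|//]]] _ /=; rewrite !delta_coord //= ?addr0 ?add0r.
Qed.

(** The vector e_1 inserted in [phi0] gives the first equation. Adding e_3 gives one more from
    [phi0], and one from each 3-form on the pair e_1, e_3. Adding e_2 + e_4 gives the last three.
    The increments 1, 4, 3 are the characters. *)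
Lemma polar_eqs k v : (k <= 7)%N ->
    admissible r v -> (forall u, u \in F k -> phi0 (reduced r) v u = 0) ->
    (forall u w, u \in F k -> w \in F k ->
        [/\ phi1 (reduced r) v u w = 0, phi2 (reduced r) v u w = 0
          & phi3 (reduced r) v u w = 0]) ->
  [/\ (0 < k)%N -> dev r v 1 = 0,
      (1 < k)%N -> [/\ dev r v 3 = 0, dev r v 5 = 0, dev r v 6 = 0
                     & dev r v 7 = 0]
    & (2 < k)%N -> [/\ dev r v 2 = 0, dev r v 4 = 0 & dev r v 8 = 0]].
Proof.
move=> k7 admv v0 v3.
have [b0 [F0 [e00 e01 e02 e03]]] := flag_basis_ex (isT : 0 < 3)%N.
have [b1 [F1 [e10 e11 e12 e13]]] := flag_basis_ex (isT : 1 < 3)%N.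
have [b2 [F2 [e20 e21 e22 e23]]] := flag_basis_ex (isT : 2 < 3)%N.
have k15 : (k <= 15)%N by apply: leq_trans k7 _.
have gF := F_graph k7.
have eb := (e00, e01, e02, e03, (e10, e11, e12, e13), (e20, e21, e22, e23)).
split=> [k0|k1|k2].
- have {}F0 := F0 _ k0 k15; have := v0 _ F0.
  have [-> _ _ _] := graph_polar admv (gF _ F0) (gF _ F0).
  by rewrite !eb /= => e; apply/esym/(eq_of_zero e); ring.
- have k0 := ltnW k1.
  have {}F0 := F0 _ k0 k15; have {}F1 := F1 _ k1 k15; have := v0 _ F1.
  have [-> _ _ _] := graph_polar admv (gF _ F1) (gF _ F1).
  have [] := v3 _ _ F0 F1.
  have [_ -> -> ->] := graph_polar admv (gF _ F0) (gF _ F1).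
  rewrite /alt2 !eb /= => e5 e6 e7 e3.
  split; [apply/esym/(eq_of_zero e3)|apply/(eq_of_zero e5)
    |apply/(eq_of_zero e6)|apply/(eq_of_zero e7)]; ring.
have k1 := ltnW k2; have k0 := ltnW k1.
have {}F0 := F0 _ k0 k15; have {}F1 := F1 _ k1 k15; have {}F2 := F2 _ k2 k15.
have := v0 _ F2; have [-> _ _ _] := graph_polar admv (gF _ F2) (gF _ F2).
have [_ _] := v3 _ _ F0 F2.
have [_ _ _ ->] := graph_polar admv (gF _ F0) (gF _ F2).
have [_ _] := v3 _ _ F1 F2.
have [_ _ _ ->] := graph_polar admv (gF _ F1) (gF _ F2).
rewrite /alt2 !eb /= => e1 e0 e.
have e2 : dev r v 8 = dev r v 2 by apply/esym/(eq_of_zero e1); ring.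
have e4 : dev r v 8 = dev r v 4 by apply/(eq_of_zero e0); ring.
(* The sum e_2 + e_4 makes [phi0] say that [dev r v 2 + dev r v 4] is 0, while [phi3] identifies
   both terms with [dev r v 8]; 2 being invertible, all three vanish. *)
have /eqP : 2 * dev r v 8 = 0.
  by apply/esym/(eq_of_zero e); rewrite -e2 -e4; ring.
by rewrite mulf_eq0 (negbTE two_neq0) -e2 -e4 /= => /eqP->.
Qed.

Lemma polar_flag k v : (k < 7)%N ->
  v \in F (polar_dim k) <-> polar T G (reduced r) (fun u => u \in F k) v.
Proof.
move=> k7; have k7' := ltnW k7.
have admF u : u \in F k -> admissible r u by case/(F_graph k7')/graph_coord.
have dim15 : (polar_dim k <= 15)%N by move: k k7 {k7' admF}; do 4?[case=> //].
rewrite (polarP v admF) memF //; split=> [[admv v0]|[admv v0 v3]]; last first.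
  split=> //; have [P1 P3 P2] := polar_eqs k7' admv v0 v3.
  move: k k7 {k7' admF dim15 v0 v3} P1 P3 P2 => [|[|[|k]]] k7 P1 P3 P2 i ki.
  - by move: ki; rewrite /polar_dim /=; lia.
  - have -> : i = 14 by move: ki; rewrite /polar_dim /=; lia.
    by rewrite /flag_coord /= P1.
  - have [p3 p5 p6 p7] := P3 isT; have p1 := P1 isT.
    move: i ki; rewrite [polar_dim 2]/=.
    case=> [|[|[|[|[|[|[|[|[|[|[|[|[|[|[|i]]]]]]]]]]]]]]] ki; by case/andP: ki.
  have [p3 p5 p6 p7] := P3 isT; have [p2 p4 p8] := P2 isT; have p1 := P1 isT.
  have /graph_coord[_] : graph (graph_mx (torsion_coef r)) v; last first.
    by apply; move: ki; rewrite /polar_dim /= nth_nil.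
  by apply/graph_torsionP; split=> //; case=> [|[|[|[|[|[|[|[|[|//]]]]]]]]].
(* For [k] at least 3, [v] lies in the reference element, which contains [F k] and is integral. *)
have [k3|k3] := ltnP 2 k.
  have gv : graph (graph_mx (torsion_coef r)) v.
    by apply/graph_coord; split=> // i ki; apply: v0;
      move: k k3 {k7 k7' admF dim15} => [|[|[|k]]] // _;
      rewrite /polar_dim /= nth_nil.
  have [_ int0 int3] := iffLR (integral_elementP _ _) (@integral_torsion r).
  by split=> // [u /(F_graph k7') gu|u w /(F_graph k7') gu /(F_graph k7') gw];
    [apply: int0|apply: int3].
have c u (Fu : u \in F k) : forall i, (k <= i < 15)%N -> flag_coord r u i = 0.
  by case/memF: Fu => //; apply: leq_trans k7' _.
have e1 u : u \in F k -> eta u 1 = 0.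
  by move=> Fu; apply: (c u Fu 2); rewrite k3.
have e3 u : u \in F k -> eta u 3 = 0.
  move=> Fu; have /subr0_eq -> : eta u 3 - eta u 1 = 0; last exact: e1.
  by apply: (c u Fu 3); rewrite (leq_trans k3).
(* For [k] at most 1, [F k] lies in the line of e_1: all the minors vanish, and only
   [eta u 0 * dev r v 1] is left. *)
have [k2|k2] := leqP 2 k; last first.
  have e2 u : u \in F k -> eta u 2 = 0.
    by move=> Fu; apply: (c u Fu 1); rewrite -ltnS k2.
  have e0 u : u \in F k -> eta u 0 * dev r v 1 = 0.
    move=> Fu; case: (posnP k) => [k0|k0].
      by rewrite (_ : eta u 0 = 0) ?mul0r //; apply: (c u Fu 0); rewrite k0.
    rewrite (_ : dev r v 1 = 0) ?mulr0 //; apply: (v0 14).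
    by rewrite (_ : k = 1%N) //; apply/eqP; rewrite eqn_leq k0 -ltnS k2.
  split=> // [u Fu|u w Fu Fw].
    have gu := F_graph k7' Fu; have [-> _ _ _] := graph_polar admv gu gu.
    by rewrite e0 // e1 // e2 // e3 //; ring.
  have [_ -> -> ->] := graph_polar admv (F_graph k7' Fu) (F_graph k7' Fw).
  by rewrite /alt2 !e1 // !e2 // !e3 //; split; ring.
have kE : k = 2 by apply/eqP; rewrite eqn_leq k3 k2.
rewrite kE in v0.
have p1 := v0 14 isT; have p3 := v0 10 isT; have p5 := v0 11 isT.
have p6 := v0 12 isT; have p7 := v0 13 isT; rewrite /flag_coord /= in p1 p3 p5 p6 p7.
split=> // [u Fu|u w Fu Fw].
  have gu := F_graph k7' Fu; have [-> _ _ _] := graph_polar admv gu gu.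
  by rewrite e1 // e3 // p1 p3; ring.
have [_ -> -> ->] := graph_polar admv (F_graph k7' Fu) (F_graph k7' Fw).
by rewrite /alt2 !e1 // !e3 // p5 p6 p7; split; ring.
Qed.

End Polar.

Lemma web_cartan_test r : cartan_test T G (reduced r) characters.
Proof.
have [F FP] := flag_spaces r.
have dimF k (k15 : (k <= 15)%N) := (FP k k15).1.
have memF k (k15 : (k <= 15)%N) := (FP k k15).2.
rewrite /cartan_test card_cof card_unk; split; first exists F; first split.
- move=> k k7; split; first by apply: dimF; apply: leq_trans k7 _.
  by apply: integral_subset (@integral_torsion r) => v; apply: F_graph memF _ _ k7.
- move=> k k7; apply/subvP => v.
  have k15 : (k.+1 <= 15)%N by apply: leq_trans k7 _.
  move=> /(iffLR (memF _ (ltnW k15) _))[admv v0]; apply/memF => //;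
    split=> // i /andP[ki i15].
  by apply: v0; rewrite (ltnW ki).
- by exists (graph_mx (torsion_coef r)) => v; rewrite memF // graph_coord.
- move=> k k7; exists (F (polar_dim k)); first by move=> v; apply: polar_flag.
  rewrite dimF /polar_dim /characters; last by move: k k7; do 4?[case=> //].
  by move: k k7; do 7?[case=> [_|]] => //; rewrite !big_ord_recr big_ord0.
- by rewrite !big_ord_recr big_ord0.
(* Equality in Cartan's test: 18 = 1 + 2 * 4 + 3 * 3. *)
have [L dimL LP] := integral_affine r.
by exists (graph_mx (torsion_coef r)), L; split=> //;
  rewrite dimL !big_ord_recr big_ord0.
Qed.

(** * The zero locus and involution *)

Lemma zero_locusP (z : unk -> R) :
  zero_locus T G z <-> z =1 reduced (fun n => z (principal n)).
Proof.
rewrite -zero_relationsP; split=> z0 e e0; last exact: gen_nil.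
by apply: z0; apply: gen_form; apply: zero_relation_eq.
Qed.

Theorem web_in_involution : in_involution T G (@a1_neq0 R) characters.
Proof.
split.
(* The zero locus is the fixed space of the linear map [z] to [reduced] of its principal part, hence
   the kernel of the difference. *)
- pose f (z : {ffun unk -> R^o}) : {ffun unk -> R^o} :=
    z - [ffun y => reduced (fun n => z (principal n)) y].
  have lin_f : linear f.
    move=> k z z'; apply/ffunP => y; rewrite /f !ffunE /=.
    rewrite (@reduced_eq _ (fun n => k * z (principal n) + z' (principal n))) =>
      [|n _]; last by rewrite !ffunE.
    by rewrite reduced_lin /GRing.scale /=; ring.
  pose f' : {linear {ffun unk -> R^o} -> {ffun unk -> R^o}} :=
    HB.pack f (GRing.isLinear.Build _ _ _ _ f lin_f).
  exists 0, (lker (linfun f')) => z; rewrite zero_locusP subr0 memv_ker lfunE /=.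
  rewrite /f subr_eq0; split=> [z0|/eqP z0 y].
    by apply/eqP/ffunP => y; rewrite ffunE.
  by rewrite {1}z0 ffunE.
- exists (reduced (fun=> 1)); first by rewrite /a1_neq0 /reduced /= oner_neq0.
  by apply/zero_locusP => y; apply: reduced_eq => n n9; rewrite reduced_principal.
move=> z _ /zero_locusP z0.
have -> : z = reduced (fun n => z (principal n)) by apply/funext.
exact: web_cartan_test.
Qed.

End WebSystem.

(** * Analytic and smooth functions *)

Section Analytic.
Variable R : realType.

(** A power series in one variable seen in [n] variables: among the exponents of sum [k], only the
    one concentrated at [i] contributes. *)
Lemma homog_part_mono n (i : 'I_n) (g : nat -> R) k (h : 'I_n -> R) :
  homog_part (fun e => if [forall j, (j != i) ==> (e j == 0%N)] then g (e i) else 0)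
    k h = g k * h i ^+ k.
Proof.
rewrite /homog_part.
pose d : {ffun 'I_n -> 'I_k.+1} := [ffun j => if j == i then ord_max else ord0].
rewrite (bigD1 d) /=; last first.
  by rewrite (bigD1 i) //= big1 ?ffunE ?eqxx ?addn0 // => j /negbTE ji;
    rewrite ffunE ji.
rewrite [X in _ + X]big1; last first.
  move=> e; case: ifP => [/forallP e0|]; last by rewrite mul0r.
  have e0' j' : j' != i -> e j' = 0%N :> nat by move=> ji; apply/eqP/(implyP (e0 j')).
  move=> /andP[/eqP sum_e /eqP[]]; apply/ffunP => j; rewrite ffunE; apply: val_inj.
  case: eqP => [->|/eqP/e0' //] /=.
  by rewrite -[RHS]sum_e (bigD1 i) //= big1 ?addn0.
rewrite addr0.
rewrite ifT; last by apply/forallP => j; apply/implyP => /negbTE ji; rewrite ffunE ji.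
rewrite ffunE eqxx /=; congr (_ * _).
rewrite (bigD1 i) //= big1 ?mulr1 ?ffunE ?eqxx // => j /negbTE ji.
by rewrite ffunE ji expr0.
Qed.

(** By the functional equation the expansion at [x] is the exponential series in [b * h 0 i],
    multiplied by the value [A] at [x]. It converges everywhere, so the radius 1 is arbitrary. *)
Lemma analytic_expR n (U : set 'rV[R]_n) (i : 'I_n) (a b : R) :
  analytic_on U (fun x => a * expR (b * x 0 i)).
Proof.
move=> x _.
pose A := a * expR (b * x 0 i).
pose g k : R := A * (b ^+ k / k`!%:R).
exists (fun e => if [forall j, (j != i) ==> (e j == 0%N)] then g (e i) else 0), 1.
split=> // h _.
have E (B y t : R) k : B * (y ^+ k / k`!%:R) * t ^+ k = B * exp_coeff (y * t) k.
  by rewrite /exp_coeff /= exprMn; ring.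
have sE (B y : R) :
    series (fun k => B * exp_coeff y k) = (fun k => B * series (exp_coeff y) k).
  by apply/funext => k; rewrite /series /= mulr_sumr.
split.
  have -> : (fun k => homog_part (fun e =>
    `|if [forall j, (j != i) ==> (e j == 0%N)] then g (e i) else 0|) k
      (fun j => `|h 0 j|)) = (fun k => `|A| * exp_coeff (`|b| * `|h 0 i|) k).
    apply/funext => k; rewrite -E.
    rewrite -[RHS](homog_part_mono i (fun k =>
      `|A| * (`|b| ^+ k / k`!%:R)) k (fun j => `|h 0 j|)).
    congr homog_part; apply/funext => e; case: ifP => _; last by rewrite normr0.
    by rewrite /g normrM normf_div normrX [`|_%:R|]ger0_norm.
  by rewrite sE; apply: is_cvgMr; apply: is_cvg_series_exp_coeff.
have -> : (fun k => homog_part (fun e =>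
  if [forall j, (j != i) ==> (e j == 0%N)] then g (e i) else 0) k
    (h 0)) = (fun k => A * exp_coeff (b * h 0 i) k).
  by apply/funext => k; rewrite homog_part_mono E.
rewrite sE mxE mulrDr expRD mulrA -/A.
by apply: cvgMr; apply: is_cvg_series_exp_coeff.
Qed.

Lemma analytic_cst n (U : set 'rV[R]_n.+1) (a : R) : analytic_on U (fun=> a).
Proof.
have -> : (fun=> a) = (fun x : 'rV[R]_n.+1 => a * expR (0 * x 0 ord0)).
  by apply/funext => x; rewrite mul0r expR0 mulr1.
exact: analytic_expR.
Qed.

End Analytic.

(** * Derivatives, affine surfaces and the mean value theorem *)

Section Derivatives.
Variable R : realType.

Lemma is_derive_coord n (i : 'I_n) (x v : 'rV[R]_n) :
  is_derive x v (fun y : 'rV[R]_n => y 0 i) (v 0 i).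
Proof.
have df := differentiable_coord x 0 i.
apply: DeriveDef; first exact: diff_derivable.
rewrite deriveE //.
have @f : {linear 'rV[R]_n -> R}.
  by exists (fun N : 'rV[R]_n => N 0 i); do 2![eexists]; do ?[constructor];
     rewrite ?mxE// => ? *; rewrite ?mxE//; move=> ?; rewrite !mxE.
rewrite (_ : (fun _ => _) = f) //.
by rewrite diff_lin //; exact: coord_continuous.
Qed.

Lemma is_derive_comp1 (V : normedModType R) (f : R -> R) (g : V -> R) x v
    (df dg : R) :
  is_derive (g x) 1 f df -> differentiable g x -> 'D_v g x = dg ->
  is_derive x v (f \o g) (df * dg).
Proof.
move=> [/derivable1_diffP dfx <-] dgx <-.
have dc : differentiable (f \o g) x by exact: differentiable_comp.
apply: DeriveDef; first exact: diff_derivable.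
rewrite (deriveE v dc) diff_comp //= (deriveE v dgx) diff1E //= derive1E.
exact: mulrC.
Qed.

Lemma derive_row n m (f : 'rV[R]_n -> 'rV[R]_m) x v :
  (forall i, derivable (fun y => f y 0 i) x v) ->
  forall i, ('D_v f x) 0 i = 'D_v (fun y => f y 0 i) x.
Proof.
move=> df i; rewrite derive_mx ?mxE //.
by apply/derivable_mxP => k j; rewrite ord1.
Qed.

Lemma smooth_differentiable n U (f : 'rV[R]_n -> R) x :
  smooth_on U f -> U x -> differentiable f x.
Proof. by move=> sf; apply: (sf [::]). Qed.

Lemma derive_pderiv n (f : 'rV[R]_n -> R) x v : differentiable f x ->
  'D_v f x = \sum_i v 0 i * pderiv i f x.
Proof.
move=> df; rewrite deriveE // {1}[v]row_sum_delta linear_sum.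
by apply: eq_bigr => i _; rewrite linearZ /pderiv deriveE.
Qed.

Lemma is_derive_affine (b m0 m1 : R) (y v : 'rV[R]_2) :
  is_derive y v (fun y : 'rV[R]_2 => b + m0 * y 0 0 + m1 * y 0 1)
    (m0 * v 0 0 + m1 * v 0 1).
Proof.
have dcoord (i : 'I_2) m := is_deriveZ m (is_derive_coord i y v).
have := is_deriveD (is_deriveD (is_derive_cst b y v) (dcoord 0 m0)) (dcoord 1 m1).
by rewrite add0r.
Qed.

Lemma differentiable_affine (b m0 m1 : R) (y : 'rV[R]_2) :
  differentiable (fun y : 'rV[R]_2 => b + m0 * y 0 0 + m1 * y 0 1) y.
Proof.
have dcoord (i : 'I_2) m := differentiableZ m (differentiable_coord y 0 i).
exact: differentiableD (differentiableD (differentiable_cst b y) (dcoord 0 m0))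
  (dcoord 1 m1).
Qed.

Lemma affine_foldr_pderiv (s : seq 'I_2) (b m0 m1 : R) :
  exists b' m0' m1', foldr (@pderiv R 2) (fun y => b + m0 * y 0 0 + m1 * y 0 1) s
    = fun y => b' + m0' * y 0 0 + m1' * y 0 1.
Proof.
elim: s => [|i s [b' [m0' [m1' IH]]]] /=; first by exists b, m0, m1.
rewrite IH; exists (m0' * (0 == i)%:R + m1' * (1 == i)%:R), 0, 0.
apply/funext => y; rewrite /pderiv.
have [_ ->] := is_derive_affine b' m0' m1' y (delta_mx 0 i).
by rewrite !mxE !eqxx /= !mul0r !addr0.
Qed.

Lemma smooth_affine (U : set 'rV[R]_2) (b m0 m1 : R) :
  smooth_on U (fun y => b + m0 * y 0 0 + m1 * y 0 1).
Proof.
move=> s x _; have [b' [m0' [m1' ->]]] := affine_foldr_pderiv s b m0 m1.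
exact: differentiable_affine.
Qed.

(** All the integral surfaces exhibited for the explicit web are affine planes in its
    coordinates. *)
Lemma affine_surface n (D : plane_field R n) (x m0 m1 : 'rV[R]_n) :
    (forall a b : R, a *: m0 + b *: m1 = 0 -> a = 0 /\ b = 0) ->
    (forall a b a' b' : R, D (x + (a *: m0 + b *: m1)) (a' *: m0 + b' *: m1)) ->
  exists S sigma, tangent_surface setT D S sigma /\ exists2 s, S s & sigma s = x.
Proof.
move=> inj tan.
pose sigma (s : 'rV[R]_2) := x + (s 0 0 *: m0 + s 0 1 *: m1).
have sigmaE i : (fun s => sigma s 0 i)
    = (fun s => x 0 i + m0 0 i * s 0 0 + m1 0 i * s 0 1).
  by apply/funext => s; rewrite !mxE; ring.
have Dsigma s v : 'D_v sigma s = v 0 0 *: m0 + v 0 1 *: m1.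
  apply/rowP => i; rewrite derive_row => [|j]; rewrite sigmaE.
    have [_ ->] := is_derive_affine (x 0 i) (m0 0 i) (m1 0 i) s v.
    by rewrite !mxE; ring.
  by apply: diff_derivable; apply: differentiable_affine.
exists setT, sigma; split; last first.
  by exists 0 => //; rewrite /sigma !mxE !scale0r !addr0.
split=> //.
- exact: openT.
- by move=> i; rewrite sigmaE; apply: smooth_affine.
- move=> s v _; rewrite Dsigma => /inj[v0 v1].
  by apply/rowP => -[[|[|//]] lt]; rewrite mxE;
    [rewrite -[RHS]v0|rewrite -[RHS]v1]; congr (v 0 _); apply: val_inj.
- by move=> s v _; rewrite Dsigma; apply: tan.
Qed.

(** The one-variable theorem on the segment from [t] to [t'], which lies in the ball by
    convexity. *)
Lemma MVT_ball n (f : 'rV[R]_n -> R) (s : 'rV[R]_n) (r : R) t t' :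
    (forall u, ball s r u -> differentiable f u) -> ball s r t -> ball s r t' ->
  exists2 u, ball s r u & f t' - f t = 'D_(t' - t) f u.
Proof.
move=> df bt bt'.
pose l (c : R) := c *: (t' - t) + t.
have bl (c : R) : 0 <= c <= 1 -> ball s r (l c).
  move=> /andP[c0 c1]; move: bt bt'; rewrite -!ball_normE /= => bt bt'.
  have -> : s - l c = (1 - c) *: (s - t) + c *: (s - t').
    by apply/rowP => i; rewrite !mxE; ring.
  apply: le_lt_trans (ler_normD _ _) _.
  rewrite !normrZ !ger0_norm ?subr_ge0 //.
  have [c00|c00] := eqVneq c 0; first by rewrite c00 subr0 mul1r mul0r addr0.
  have c_gt0 : 0 < c by rewrite lt_def c00.
  have : c * `|s - t'| < c * r by rewrite ltr_pM2l.
  have : (1 - c) * `|s - t| <= (1 - c) * r by rewrite ler_wpM2l ?subr_ge0 // ltW.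
  lra.
have dl (c : R) : is_diff c l ( *:%R^~ (t' - t)).
  have := is_diffD (is_diff_scalel c (t' - t)) (is_diff_cst t c).
  by rewrite addr0.
have dg (c : R) : 0 <= c <= 1 -> is_derive c 1 (f \o l) ('D_(t' - t) f (l c)).
  move=> c01; have dfl := df _ (bl c c01); have [dlc dlE] := dl c.
  have dfg : differentiable (f \o l) c by apply: differentiable_comp.
  apply: DeriveDef; first exact: diff_derivable.
  by rewrite deriveE // diff_comp //= dlE scale1r deriveE.
have [||c c01] := @MVT_segment R (f \o l) (fun c => 'D_(t' - t) f (l c)) 0 1 ler01.
- by move=> c; rewrite in_itv /= => /andP[c0 c1]; apply: dg; rewrite !ltW.
- apply: continuous_in_subspaceT => c; rewrite inE /= in_itv /= => c01.
  apply: differentiable_continuous.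
  by apply/derivable1_diffP; have [] := dg c c01.
rewrite subr0 mulr1 /= /l scale1r scale0r add0r subrK => ->.
by exists (l c) => //; apply: bl; move: c01; rewrite in_itv.
Qed.

End Derivatives.

(** * An explicit web *)

Section GroupWeb.
Variable R : realType.
Implicit Types (x v : 'rV[R]_4).

Lemma ord3_ind (P : 'I_3 -> Prop) : P 0 -> P 1 -> P 2%:R -> forall u, P u.
Proof.
move=> P0 P1 P2 [[|[|[|m]]] lt_m] //.
- by rewrite (_ : Ordinal lt_m = 0) //; apply: val_inj.
- by rewrite (_ : Ordinal lt_m = 1) //; apply: val_inj.
- by rewrite (_ : Ordinal lt_m = 2%:R) //; apply: val_inj.
Qed.

Definition scale1 (i : 'I_2) x : R := if i == 0 then 1 else expR (x 0 0).
Definition scale2 (i : 'I_2) x : R := if i == 0 then 1 else expR (- x 0 2%R).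

(** The forms of the [u]-th foliation are [weight1 u] times omega_(1) plus [weight2 u] times
    omega_(2); the normalization says that each family of weights has sum 0. *)
Definition weight1 (u : 'I_3) : R := nth 0 [:: 1; 0; -1] u.
Definition weight2 (u : 'I_3) : R := nth 0 [:: 0; 1; -1] u.

Definition group_web : web_data R := WebData setT (fun u i j x =>
  weight1 u * (j == i :> nat)%:R * scale1 i x
  + weight2 u * (j == (i + 2)%N :> nat)%:R * scale2 i x).

Definition group_conn (i j : 'I_2) : oneform R 4 := fun _ _ => 0.
Definition group_a (i : 'I_2) (x : 'rV[R]_4) : R := (i == 0)%:R.

Local Notation c1 := (1 : 'I_4).
Local Notation c2 := (2%:R : 'I_4).
Local Notation c3 := (3%:R : 'I_4).

Lemma sum4 (F : 'I_4 -> R) : \sum_i F i = F 0 + F c1 + F c2 + F c3.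
Proof.
rewrite !big_ord_recr big_ord0 /= add0r.
by congr (F _ + F _ + F _ + F _); apply: val_inj.
Qed.

Lemma sum2 (F : 'I_2 -> R) : \sum_i F i = F 0 + F 1.
Proof.
rewrite !big_ord_recr big_ord0 /= add0r.
by congr (F _ + F _); apply: val_inj.
Qed.

Lemma form0E u x v :
  form_at (wform group_web u 0) x v = weight1 u * v 0 0 + weight2 u * v 0 c2.
Proof. by rewrite /form_at sum4 /= /scale1 /scale2 /=; ring. Qed.

Lemma form1E u x v : form_at (wform group_web u 1) x v
  = weight1 u * expR (x 0 0) * v 0 c1 + weight2 u * expR (- x 0 c2) * v 0 c3.
Proof. by rewrite /form_at sum4 /= /scale1 /scale2 /=; ring. Qed.

Lemma ord4_ind (P : 'I_4 -> Prop) : P 0 -> P c1 -> P c2 -> P c3 -> forall u, P u.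
Proof.
move=> P0 P1 P2 P3 [[|[|[|[|m]]]] lt_m] //.
- by rewrite (_ : Ordinal lt_m = 0) //; apply: val_inj.
- by rewrite (_ : Ordinal lt_m = c1) //; apply: val_inj.
- by rewrite (_ : Ordinal lt_m = c2) //; apply: val_inj.
- by rewrite (_ : Ordinal lt_m = c3) //; apply: val_inj.
Qed.

Lemma group_web_analytic u i : analytic_form (wdom group_web) (wform group_web u i).
Proof.
have cst0 c : analytic_on setT (fun _ : 'rV[R]_4 => c) by apply: analytic_cst.
have exp1 c : analytic_on setT (fun x : 'rV[R]_4 => c * expR (x 0 0)).
  rewrite (_ : (fun _ => _) = (fun x : 'rV[R]_4 => c * expR (1 * x 0 0))).
    exact: analytic_expR.
  by apply/funext => x; rewrite mul1r.
have exp2 c : analytic_on setT (fun x : 'rV[R]_4 => c * expR (- x 0 c2)).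
  rewrite (_ : (fun _ => _) = (fun x : 'rV[R]_4 => c * expR (-1 * x 0 c2))).
    exact: analytic_expR.
  by apply/funext => x; rewrite mulN1r.
move=> j; elim/ord2_ind: i; rewrite /= /scale1 /scale2 /=; first exact: cst0.
elim/ord4_ind: j => /=.
- rewrite (_ : (fun _ => _) = fun=> 0); first exact: cst0.
  by apply/funext => x; ring.
- rewrite (_ : (fun _ => _) = fun x => weight1 u * expR (x 0 0)); first exact: exp1.
  by apply/funext => x; ring.
- rewrite (_ : (fun _ => _) = fun=> 0); first exact: cst0.
  by apply/funext => x; ring.
- rewrite (_ : (fun _ => _) = fun x => weight2 u * expR (- x 0 c2));
    first exact: exp2.
  by apply/funext => x; ring.
Qed.

Definition row4 (a b c d : R) : 'rV[R]_4 := \row_i nth 0 [:: a; b; c; d] i.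

Lemma row4E a b c d : (row4 a b c d 0 0 = a) * (row4 a b c d 0 c1 = b)
  * (row4 a b c d 0 c2 = c) * (row4 a b c d 0 c3 = d).
Proof. by rewrite /row4 !mxE. Qed.

Lemma row4_eq0 v : v 0 0 = 0 -> v 0 c1 = 0 -> v 0 c2 = 0 -> v 0 c3 = 0 -> v = 0.
Proof. by move=> v0 v1 v2 v3; apply/rowP; elim/ord4_ind; rewrite mxE. Qed.

Lemma group_web_general u u' x v : u != u' ->
  leaf_dist group_web u x v -> leaf_dist group_web u' x v -> v = 0.
Proof.
move=> uu' Lu Lu'.
have := Lu 0; have := Lu 1; have := Lu' 0; have := Lu' 1.
rewrite !form0E !form1E.
have e0 : expR (x 0 0) != 0 by rewrite gt_eqF ?expR_gt0.
have e2 : expR (- x 0 c2) != 0 by rewrite gt_eqF ?expR_gt0.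
move=> h1' h0' h1 h0.
have [v00 v02] : v 0 0 = 0 /\ v 0 c2 = 0.
  move: uu' h0 h0' {h1 h1' Lu Lu'}; elim/ord3_ind: u; elim/ord3_ind: u' => //= _;
    rewrite /weight1 /weight2 /= => h h'; split; lra.
have [v01 v03] : expR (x 0 0) * v 0 c1 = 0 /\ expR (- x 0 c2) * v 0 c3 = 0.
  move: uu' h1 h1' {h0 h0' Lu Lu'}; elim/ord3_ind: u; elim/ord3_ind: u' => //= _;
    rewrite /weight1 /weight2 /= => h h'; split; lra.
apply: row4_eq0 => //.
- by move/eqP: v01; rewrite mulf_eq0 (negbTE e0) => /eqP.
- by move/eqP: v03; rewrite mulf_eq0 (negbTE e2) => /eqP.
Qed.

Lemma group_web_integrable u : integrable2 setT (leaf_dist group_web u).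
Proof.
move=> x _.
have inj2 (m0 m1 : 'rV[R]_4) j0 j1 : m0 0 j0 = 1 -> m1 0 j0 = 0 -> m0 0 j1 = 0 ->
  m1 0 j1 = 1 ->
  forall a b : R, a *: m0 + b *: m1 = 0 -> a = 0 /\ b = 0.
  move=> m00 m10 m01 m11 a b e; split.
    by have := congr1 (fun w : 'rV[R]_4 => w 0 j0) e;
      rewrite !mxE m00 m10 mulr1 mulr0 addr0.
  by have := congr1 (fun w : 'rV[R]_4 => w 0 j1) e;
    rewrite !mxE m01 m11 mulr1 mulr0 add0r.
elim/ord3_ind: u.
- apply: (@affine_surface _ _ _ x (row4 0 0 1 0) (row4 0 0 0 1)).
    by apply: (inj2 _ _ c2 c3); rewrite row4E.
  move=> a b a' b'; elim/ord2_ind;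
    rewrite ?form0E ?form1E /weight1 /weight2 /= !mxE /=; ring.
- apply: (@affine_surface _ _ _ x (row4 1 0 0 0) (row4 0 1 0 0)).
    by apply: (inj2 _ _ 0 c1); rewrite row4E.
  move=> a b a' b'; elim/ord2_ind;
    rewrite ?form0E ?form1E /weight1 /weight2 /= !mxE /=; ring.
(* Along a leaf of the third foliation the sum of coordinates 0 and 2 is constant, hence so is the
   slope of du against dv, and the leaf is a plane. *)
- apply: (@affine_surface _ _ _ x (row4 1 0 (-1) 0)
    (row4 0 (- expR (- x 0 0 - x 0 c2)) 0 1)).
    by apply: (inj2 _ _ 0 c3); rewrite row4E.
  move=> a b a' b'; elim/ord2_ind;
    rewrite ?form0E ?form1E /weight1 /weight2 /= !mxE /=.
    ring.
  have -> : expR (- (x 0 c2 + (a * -1 + b * 0)))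
     = expR (x 0 0 + (a * 1 + b * 0)) * expR (- x 0 0 - x 0 c2).
    by rewrite -expRD; congr expR; ring.
  ring.
Qed.

Lemma group_web_is_web : is_web group_web.
Proof.
split.
- exact: openT.
- by exists 0.
- exact: group_web_analytic.
- by move=> u u' x v uu' _; apply: group_web_general.
- exact: group_web_integrable.
Qed.

Lemma group_web_normalized : normalized group_web.
Proof.
move=> i x v _; rewrite !big_ord_recr big_ord0 /= add0r.
by elim/ord2_ind: i; rewrite ?form0E ?form1E /weight1 /weight2 /=; ring.
Qed.

(** The connection being zero, it all comes down to d(e^x du) = dx /\ e^x du and d(e^-y dv) = - dy
    /\ e^-y dv, the terms in a = (1, 0). *)
Lemma group_structure : structure_equations group_web group_conn group_a.
Proof.
have D u j x k : pderiv k (wform group_web u 0 j) x = 0.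
  by rewrite /pderiv /= /scale1 /scale2 /= derive_cst.
have dE (b c : R) x (v : 'rV[R]_4) (i : 'I_4) :
    is_derive x v (fun y : 'rV[R]_4 => c * expR (b * y 0 i))
      (c * (expR (b * x 0 i) * (b * v 0 i))).
  have [_ db] := is_deriveZ b (is_derive_coord i x v).
  have dg := differentiableZ b (differentiable_coord x 0 i).
  exact: (is_deriveZ c (is_derive_comp1 (is_derive_expR _) dg db)).
have D1 u j x k : pderiv k (wform group_web u 1 j) x
    = weight1 u * (j == c1)%:R * (k == 0)%:R * expR (x 0 0)
      - weight2 u * (j == c3)%:R * (k == c2)%:R * expR (- x 0 c2).
  pose A := weight1 u * (j == 1%N :> nat)%:R.
  pose B := weight2 u * (j == 3%N :> nat)%:R.
  have [_] := is_deriveD (dE 1 A x (delta_mx 0 k) 0) (dE (-1) B x (delta_mx 0 k) c2).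
  have -> : (fun y : 'rV[R]_4 => A * expR (1 * y 0 0))
      + (fun y : 'rV[R]_4 => B * expR (-1 * y 0 c2)) = wform group_web u 1 j.
    by apply/funext => y; rewrite /= -[LHS]/(_ + _) mul1r mulN1r.
  rewrite /pderiv => ->; rewrite !mxE !eqxx /= !(eq_sym _ k) mul1r mulN1r.
  by rewrite /A /B -!val_eqE /=; ring.
have form_conn i j x v : form_at (group_conn i j) x v = 0.
  by rewrite /form_at big1 // => k _; rewrite mul0r.
have dform0 u x v w : dform (wform group_web u 0) x v w = 0.
  by rewrite /dform big1 // => i _; rewrite big1 // => j _; rewrite D mul0r.
have dform1 u x v w : dform (wform group_web u 1) x v w =
    weight1 u * expR (x 0 0) * (v 0 0 * w 0 c1 - w 0 0 * v 0 c1)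
    - weight2 u * expR (- x 0 c2) * (v 0 c2 * w 0 c3 - w 0 c2 * v 0 c3).
  by rewrite /dform !sum4 !D1 /=; ring.
split.
- by move=> i j k; apply: analytic_cst.
- by move=> i; apply: analytic_cst.
- move=> i x v w _; rewrite !sum2 /wedge2 !form_conn /group_a.
  by elim/ord2_ind: i; rewrite ?dform0 ?dform1 ?form0E ?form1E /weight1 /weight2
    /=; ring.
- move=> i x v w _; rewrite !sum2 /wedge2 !form_conn /group_a.
  by elim/ord2_ind: i; rewrite ?dform0 ?dform1 ?form0E ?form1E /weight1 /weight2
    /=; ring.
Qed.

(** * The transversal distribution of the explicit web *)

Lemma group_a_dist x v : a_dist group_web group_a x v <-> v 0 0 = 0 /\ v 0 c2 = 0.
Proof.
rewrite /a_dist !sum2 /group_a !form0E /weight1 /weight2 /=.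
by split=> -[e0 e2]; split; move: e0 e2; lra.
Qed.

(** Contraction with a = (1, 0) keeps the first component of the covariant derivative. The first
    component of [Y] vanishes on the neighbourhood [N], hence so does its derivative, and theta_2^1
    is zero. *)
Lemma group_geodesicly_parallel : geodesicly_parallel group_web group_conn group_a.
Proof.
split.
  move=> x _; apply: (@affine_surface _ _ _ x (row4 0 1 0 0) (row4 0 0 0 1)).
    move=> a b e; split.
      by have := congr1 (fun w : 'rV[R]_4 => w 0 c1) e;
        rewrite !mxE /= mulr1 mulr0 addr0.
    by have := congr1 (fun w : 'rV[R]_4 => w 0 c3) e;
      rewrite !mxE /= mulr1 mulr0 add0r.
  by move=> a b a' b'; apply/group_a_dist; rewrite !mxE /= !mulr0 addr0.
move=> p q N Y oN _ smY YD x X Nx.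
have tors k : torsion group_a 0 1 k x = 0.
  by rewrite /torsion /group_a /= mulr0 mul0r subr0 mul0r.
have th : theta group_web group_conn group_a p q 1 0 x X = 0.
  rewrite /theta big1 ?addr0 => [|k _]; last by rewrite tors mul0r.
  by rewrite /form_at big1 // => k _; rewrite mul0r.
have Y0 (u : 'I_3) y : N y -> form_at (wform group_web u 0) y (Y y) = 0.
  by move=> /YD/group_a_dist[Y0 Y2]; rewrite form0E Y0 Y2 !mulr0 addr0.
have D0 (u : 'I_3) : 'D_X (fun y => form_at (wform group_web u 0) y (Y y)) x = 0.
  rewrite -[RHS](derive_cst (0 : R) x X); apply: near_eq_derive.
  have : nbhs x N by apply: open_nbhs_nbhs.
  by apply: filterS => y; apply: Y0.
by split; rewrite sum2 /group_a /= mul1r mul0r addr0 /covariant_comp sum2 D0 (Y0 _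
  x Nx) th mul0r mulr0 !addr0.
Qed.

Lemma det2 (A : 'M[R]_2) : \det A = A 0 0 * A 1 1 - A 0 1 * A 1 0.
Proof.
rewrite (expand_det_row _ 0) sum2 /cofactor !det_mx11 !mxE /=.
have -> : lift 0 0 = 1 :> 'I_2 by apply: val_inj.
have -> : lift 1 0 = 0 :> 'I_2 by apply: val_inj.
by rewrite expr0 expr1; ring.
Qed.

(** On a section the coordinates 0 and 2 are locally constant, so the other two, [f] and [g], form a
    local chart [phi] in which the three forms have constant coefficients [l]. *)
Lemma group_hexagonal : hexagonal_sections group_web group_a.
Proof.
move=> S sigma [oS smS _ imm tan] s Ss.
pose f y := sigma y 0 c1; pose g y := sigma y 0 c3.
have dS i t : S t -> differentiable (fun y => sigma y 0 i) t.
  exact: smooth_differentiable.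
have Dcoord i (t v : 'rV[R]_2) : S t ->
  ('D_v sigma t) 0 i = 'D_v (fun y => sigma y 0 i) t.
  by move=> St; apply: derive_row => j; apply: diff_derivable; apply: dS.
have tan02 (t v : 'rV[R]_2) : S t -> 'D_v (fun y => sigma y 0 0) t = 0
    /\ 'D_v (fun y => sigma y 0 c2) t = 0.
  by move=> St; rewrite -!Dcoord //; apply/group_a_dist; apply: tan.
have imm' (t v : 'rV[R]_2) : S t -> 'D_v f t = 0 -> 'D_v g t = 0 -> v = 0.
  move=> St Df Dg; apply: (imm t) => //; have [D0 D2] := tan02 t v St.
  by apply: row4_eq0; rewrite Dcoord.
have DE i t (v : 'rV[R]_2) : S t -> 'D_v (fun y => sigma y 0 i) t
    = v 0 0 * pderiv 0 (fun y => sigma y 0 i) t + v 0 1 * pderiv 1 (fun y =>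
      sigma y 0 i) t.
  by move=> St; rewrite derive_pderiv ?sum2 //; apply: dS.
(* The Jacobian of [phi] with its two gradients taken at different points, because the mean value
   theorem gives separate intermediate points for [f] and [g]. *)
pose J (t t' : 'rV[R]_2) := pderiv 0 f t * pderiv 1 g t' - pderiv 1 f t * pderiv 0
  g t'.
have J0 : J s s != 0.
  (* If it vanished at [s], both differentials would kill the vector (f_1, -f_0), so the gradient of
     f would be 0; then (g_1, -g_0) shows that of g to be 0, and (1, 0) contradicts the
     immersion. *)
  apply/eqP => J0.
  pose r2 (a b : R) : 'rV[R]_2 := \row_i (if i == 0 then a else b).
  have r20 a b : r2 a b = 0 -> a = 0 /\ b = 0.
    by move=> e; have := congr1 (fun w : 'rV[R]_2 => w 0 0) e;
      have := congr1 (fun w : 'rV[R]_2 => w 0 1) e; rewrite !mxE.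
  have [f1 /eqP] : pderiv 1 f s = 0 /\ - pderiv 0 f s = 0.
    apply: r20; apply: (imm' s _ Ss); rewrite (DE _ _ _ Ss) !mxE /=;
      first by rewrite /f; ring.
    by move/eqP: J0; rewrite /J -oppr_eq0 => /eqP <-; rewrite /f /g; ring.
  rewrite oppr_eq0 => /eqP f0.
  have [g1 /eqP] : pderiv 1 g s = 0 /\ - pderiv 0 g s = 0.
    apply: r20; apply: (imm' s _ Ss); rewrite (DE _ _ _ Ss) !mxE /=;
      last by rewrite /g; ring.
    by rewrite -/f f0 f1; ring.
  rewrite oppr_eq0 => /eqP g0.
  have [/eqP] : (1 : R) = 0 /\ (0 : R) = 0; last by rewrite oner_eq0.
  apply: r20; apply: (imm' s _ Ss); rewrite (DE _ _ _ Ss) !mxE /=.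
    by rewrite -/f f0 f1; ring.
  by rewrite -/g g0 g1; ring.
have cJ : (fun tt : 'rV[R]_2 * 'rV[R]_2 => J tt.1 tt.2) @ (s, s) --> J s s.
  have cp i (j : 'I_4) : pderiv i (fun y => sigma y 0 j) @ s --> pderiv i (fun y =>
    sigma y 0 j) s.
    by apply: differentiable_continuous; apply: (smS j [:: i]).
  have c1' i j : (fun tt : 'rV[R]_2 * 'rV[R]_2 => pderiv i (fun y =>
    sigma y 0 j) tt.1) @ (s, s) --> pderiv i (fun y => sigma y 0 j) s.
    by apply: cvg_comp (cp i j); apply: cvg_fst.
  have c2' i j : (fun tt : 'rV[R]_2 * 'rV[R]_2 => pderiv i (fun y =>
    sigma y 0 j) tt.2) @ (s, s) --> pderiv i (fun y => sigma y 0 j) s.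
    by apply: cvg_comp (cp i j); apply: cvg_snd.
  exact: (cvgB (cvgM (c1' 0 c1) (c2' 1 c3)) (cvgM (c1' 1 c1) (c2' 0 c3))).
(* By continuity [J] is nonzero on a product of neighbourhoods of [s]; a ball in both of them makes
   [phi] injective. *)
have [[A B] /= [sA sB] AB] := cvgr_neq0 _ cJ J0.
have /nbhs_ballP[r /= r0 rN] : nbhs s (A `&` B `&` S).
  by apply: filterI; [apply: filterI|apply: open_nbhs_nbhs].
have NA t : ball s r t -> A t by move=> /rN[[]].
have NB t : ball s r t -> B t by move=> /rN[[]].
have NS t : ball s r t -> S t by move=> /rN[].
have mvt i t t' : ball s r t -> ball s r t' -> exists2 u, ball s r u &
    sigma t' 0 i - sigma t 0 i = 'D_(t' - t) (fun y => sigma y 0 i) u.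
  by apply: MVT_ball => u /NS; apply: dS.
have const0 t : ball s r t ->
  sigma t 0 0 = sigma s 0 0 /\ sigma t 0 c2 = sigma s 0 c2.
  move=> Nt; have Ns : ball s r s by apply: ballxx.
  have [u /NS/tan02-/(_ (t - s))[D0 _] E0] := mvt 0 s t Ns Nt.
  have [u' /NS/tan02-/(_ (t - s))[_ D2] E2] := mvt c2 s t Ns Nt.
  by split; apply/subr0_eq; rewrite ?E0 ?E2.
pose phi t : 'rV[R]_2 := \row_i (if i == 0 then f t else g t).
pose l u : 'cV[R]_2 := \col_i (if i == 0 then weight1 u * expR (sigma s 0 0)
                               else weight2 u * expR (- sigma s 0 c2)).
have Dphi (t v : 'rV[R]_2) : ball s r t ->
  'D_v phi t = \row_i (if i == 0 then 'D_v f t else 'D_v g t).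
  move=> Nt; apply/rowP => i; rewrite derive_row.
    by rewrite mxE; elim/ord2_ind: i => /=; congr ('D_v _ t); apply/funext => y;
      rewrite mxE.
  move=> j; rewrite (_ : (fun y => _) = if j == 0 then f else g); last first.
    by elim/ord2_ind: j; apply/funext => y; rewrite mxE.
  by apply: diff_derivable; case: ifP => _; apply/dS/NS.
exists (ball s r), phi, l; split=> //.
- exact: ball_open.
- exact: ballxx.
split.
- move=> j; rewrite (_ : (fun y => _) = if j == 0 then f else g); last first.
    by elim/ord2_ind: j; apply/funext => y; rewrite mxE.
  by case: ifP => _ q t Nt; apply/smS/NS.
- move=> t t' Nt Nt' e.
  have ft : f t = f t' by have := congr1 (fun w : 'rV[R]_2 => w 0 0) e; rewrite !mxE.
  have gt : g t = g t' by have := congr1 (fun w : 'rV[R]_2 => w 0 1) e; rewrite !mxE.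
  have [u Nu] := mvt c1 t t' Nt Nt'; have [u' Nu'] := mvt c3 t t' Nt Nt'.
  rewrite -/(f t) -/(f t') -/(g t) -/(g t') ft gt !subrr !DE; try exact: NS.
  rewrite -/f -/g => Eg Ef.
  have Ju : J u u' != 0 by apply: (AB (u, u')); split; [apply: NA|apply: NB].
  have e0 : (t' - t) 0 0 * J u u' = 0.
    transitivity (0 * pderiv 1 g u' - pderiv 1 f u * 0 : R); last by ring.
    by rewrite {1}Ef Eg /J; ring.
  have e1 : (t' - t) 0 1 * J u u' = 0.
    transitivity (pderiv 0 f u * 0 - 0 * pderiv 0 g u' : R); last by ring.
    by rewrite {1}Eg Ef /J; ring.
  apply/esym/subr0_eq/rowP; elim/ord2_ind; apply/eqP; rewrite [X in _ == X]mxE.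
    by move/eqP: e0; rewrite mulf_eq0 (negbTE Ju) orbF.
  by move/eqP: e1; rewrite mulf_eq0 (negbTE Ju) orbF.
- move=> t v Nt; rewrite Dphi // => e; apply: (imm' t); first exact: NS.
    by have := congr1 (fun w : 'rV[R]_2 => w 0 0) e; rewrite !mxE.
  by have := congr1 (fun w : 'rV[R]_2 => w 0 1) e; rewrite !mxE.
- move=> u u' uu'.
  have -> : \det (row_mx (l u) (l u')) = expR (sigma s 0 0) * expR (- sigma s 0 c2)
      * (weight1 u * weight2 u' - weight1 u' * weight2 u).
    have mxl (a b : 'cV[R]_2) i : row_mx a b i (0 : 'I_2) = a i 0.
      by rewrite -(row_mxEl a b); congr (row_mx a b i _); apply: val_inj.
    have mxr (a b : 'cV[R]_2) i : row_mx a b i (1 : 'I_2) = b i 0.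
      by rewrite -(row_mxEr a b); congr (row_mx a b i _); apply: val_inj.
    by rewrite det2 !mxl !mxr !mxE /=; ring.
  apply: mulf_neq0; first by rewrite -expRD gt_eqF ?expR_gt0.
  move: uu'; elim/ord3_ind: u; elim/ord3_ind: u' => //= _;
    rewrite /weight1 /weight2 /= ?(mul0r, mulr0, mul1r, mulr1, mulrN1, subr0,
      sub0r, oppr_eq0, opprK, oner_neq0) //.
move=> t u v Nt; rewrite Dphi //.
have -> : ((\row_i (if i == 0 then 'D_v f t else 'D_v g t)) *m l u) 0 0
    = weight1 u * expR (sigma t 0 0) * 'D_v f t
      + weight2 u * expR (- sigma t 0 c2) * 'D_v g t.
  by have [-> ->] := const0 t Nt; rewrite mxE sum2 !mxE /=; ring.
have [D0 D2] := tan02 t v (NS t Nt).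
rewrite /f /g -!Dcoord; try exact: NS.
split=> [Lu|e]; first by rewrite -form1E; apply: Lu.
by elim/ord2_ind; rewrite ?form0E ?form1E // !Dcoord ?D0 ?D2 ?mulr0 ?addr0 //;
  exact: NS.
Qed.

End GroupWeb.

Theorem theorem8 (R : realType) :
  (exists (W : web_data R) (conn : 'I_2 -> 'I_2 -> oneform R 4)
          (a : 'I_2 -> 'rV[R]_4 -> R),
     is_web W /\ normalized W /\ structure_equations W conn a /\
     nowhere_zero W a /\ geodesicly_parallel W conn a /\
     hexagonal_sections W a)
  /\
  (exists s : nat -> nat,
     in_involution (@web_cof_d R) (@web_equations R) (@a1_neq0 R) s /\
     s 3%N = 3%N /\ (forall k : nat, (3 < k)%N -> s k = 0%N)).
Proof.
split; last first.
  exists characters; split; last by split=> // -[|[|[|[|k]]]] //;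
    rewrite /characters /= nth_nil.
  (* The reals have characteristic 0, so 2 is nonzero. *)
  by apply: web_in_involution; rewrite pnatr_eq0.
exists (group_web R), (@group_conn R), (@group_a R); split;
  first exact: group_web_is_web.
split; first exact: group_web_normalized.
split; first exact: group_structure.
split; first by move=> x _; exists 0; rewrite /group_a oner_neq0.
split; [exact: group_geodesicly_parallel | exact: group_hexagonal].
Qed.
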